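(* For every choice of positive integers $a, b$, there exists a finite solvable group $G$ such that the character degree graph $\Delta = \Delta(G)$ has diameter three, with $|\alpha_{\Delta}| = a$ and $|\delta_{\Delta}| \geq b$.
   Context: For a finite group $G$, $\mathrm{cd}(G)=\{\chi(1)\mid \chi\in\mathrm{Irr}(G)\}$ is the set of degrees of the irreducible complex characters of $G$. The character degree graph $\Delta(G)$ has as vertex set $\mathrm{V}(G)$ the set of all primes dividing some element of $\mathrm{cd}(G)$; two distinct primes $p,q$ are adjacent if $pq$ divides some element of $\mathrm{cd}(G)$. Let $G$ be a finite solvable group such that $\Delta=\Delta(G)$ is connected of diameter three. It is known that $G$ has a unique non-abelian Sylow subgroup $P$ (it is normal in $G$), and that, with $\gamma_3(P)=[P',P]$ the third term of the descending central series of $P$, the graph $\Delta(G/\gamma_3(P))$ is a disconnected subgraph of $\Delta(G)$ with the same vertex set, having exactly two connected components. Denote by $\pi_0$ and $\pi_1$ the vertex sets of these two components, where $\pi_1$ is the one containing the prime divisor $p$ of $|P|$. Define: - $\alpha_\Delta\subseteq\pi_0$: the set of vertices in $\pi_0$ that are not adjacent in $\Delta$ to any vertex in $\pi_1$; - $\beta_\Delta=\pi_0\setminus\alpha_\Delta$; - $\delta_\Delta\subseteq\pi_1$: the set of vertices in $\pi_1$ that are not adjacent in $\Delta$ to any vertex in $\pi_0$; - $\gamma_\Delta=\pi_1\setminus\delta_\Delta$. *)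

(* Defs.v *)
From HB Require Import structures.
From mathcomp Require Import all_boot all_order all_fingroup all_algebra.
From mathcomp Require Import all_solvable all_field all_character finmap.

Set Implicit Arguments.
Unset Strict Implicit.
Unset Printing Implicit Defensive.

Import GroupScope GRing.Theory Num.Theory.
Local Open Scope fset_scope.
Local Open Scope nat_scope.

(* A graph is given by a finite vertex set V and an adjacency relation e on an
   ambient type T; e is meant to relate only elements of V. *)
Section Graph.

Variables (T : choiceType) (V : {fset T}) (e : rel T).
Implicit Types (x y : T) (s : seq T) (C : {fset T}).

Definition walk x y s := path e x s && (last x s == y).

Definition connected x y := exists s, walk x y s.

Definition is_distance x y n :=
  (exists2 s, walk x y s & size s = n) /\ (forall s, walk x y s -> n <= size s).

(* The first conjunct entails that the graph is connected. *)
Definition has_diameter n :=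
  (forall x y, x \in V -> y \in V -> exists2 m, is_distance x y m & m <= n) /\
  (exists x y, [/\ x \in V, y \in V & is_distance x y n]).

Definition is_component C :=
  exists2 x, x \in V & forall y, y \in C <-> y \in V /\ connected x y.

End Graph.

Section CharacterDegreeGraph.

Variable gT : finGroupType.
Implicit Types (G P Q : {group gT}) (p q : nat).

(* Degrees of characters are natural numbers inside algC, so truncn only
   changes their type. *)
Definition cd G : {fset nat} :=
  [fset Num.truncn ('chi[G]_i 1%g) | i : Iirr G].

Definition vertices G : {fset nat} :=
  [fset p | p in flatten [seq primes d | d <- cd G]].

Definition adjacent G : rel nat := fun p q =>
  [&& p \in vertices G, q \in vertices G, p != q &
      has (fun d => p * q %| d) (cd G)].

End CharacterDegreeGraph.

Section DegreeGraphSplitting.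

Variable gT : finGroupType.
Implicit Types (G P Q : {group gT}) (p q : nat).

(* As conjugates of P in G are again non-abelian Sylow subgroups, uniqueness
   makes P normal in G. *)
Definition unique_nonabelian_Sylow p G P :=
  [/\ prime p, p.-Sylow(G) P, ~~ abelian P &
      forall Q, Sylow G Q -> ~~ abelian Q -> Q :=: P].

(* 'L_n is indexed from 'L_1(P) = P, so that 'L_3(P) = [~: P^`(1), P]; it is
   characteristic in P, hence normal in G when P is. *)
Definition component_pair p G P (pi0 pi1 : {fset nat}) :=
  let H := (G / 'L_3(P))%G in
  [/\ pi0 != pi1, p \in pi1 &
      forall C, is_component (vertices H) (adjacent H) C
                <-> C = pi0 \/ C = pi1].

(* Below, pi0 and pi1 come from the graph of G / 'L_3(P), while adjacency is
   taken in the graph of G. *)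
Definition alpha G (pi0 pi1 : {fset nat}) : {fset nat} :=
  [fset q in pi0 | all (fun r => ~~ adjacent G q r) pi1].

Definition delta G (pi0 pi1 : {fset nat}) : {fset nat} :=
  [fset q in pi1 | all (fun r => ~~ adjacent G q r) pi0].

End DegreeGraphSplitting.

(* Main.v *)
Require Import Defs.
From mathcomp Require Import all_boot all_fingroup all_solvable finmap.
From mathcomp Require Import all_order all_algebra all_field all_character.
From mathcomp Require Import ring zify.

(** Let q = 2^f with f odd, let m be an odd product of a distinct primes
    greater than 3, put n = 3 m, d = q^2 + q + 1 and F = GF(q^n), and let X be
    an indeterminate with X a = a^q X for a in F.  The 2-group P consists of
    the polynomials 1 + a X + b X^2 + e X^3 modulo X^4.  It is acted on by the
    multiplicative group C of F, where u maps X to u X, hence b X^2 to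
    u^(q+1) b X^2 and e X^3 to u^d e X^3, and by the Galois group S of order n
    of F over GF(q).  The group is G = P : (C : S).  Write Z for the layer of
    the polynomials 1 + e X^3, which is both the third term of the lower
    central series of P and central in P, N for P C, M for P C0 where C0 is the
    subgroup of order d of C that centralizes Z, and K for N T where T is the
    subgroup of order m of S, which centralizes C0.

    The components pi0 and pi1 are the primes of n and of 2 (q^n - 1).  Both
    are cliques, already in G / Z: a linear character of C in a regular S-orbit
    has a degree divisible by n above it (exists_deg_index), and a nonlinear
    character of P / Z has a trivial stabilizer in C, so that 2 (q^n - 1)
    divides the degrees above it (exists_deg_pindex).

    The rest depends on the stabilizers in G of the irreducible characters of
    P, and these are found without computing a single character.  By Brauer's
    permutation lemma an element of G fixes as many irreducible characters of P
    as conjugacy classes of P.  An element of C0 other than 1 fixes only the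
    classes inside Z, and an element of C outside C0 only the class of 1.
    Hence the characters of P fall into the set J1 of those fixed by C0, which
    restriction to Z maps bijectively and G-equivariantly onto Irr Z
    (central_Iirr_onto, central_Iirr_inj), and the set J2 of those with trivial
    stabilizer in C.  Subtracting the fixed points of J1, every element of G
    fixes as many members of J2 as classes of P outside Z (card_fix_J2); by
    orbit counting G and N then have as many orbits on J2 as on these classes
    (orbit_eq_transfer).  Every element of P outside Z is conjugate under N to
    one with coordinates in GF(q), which S centralizes (classG_out).  So
    N-orbits are G-orbits on those classes, hence on J2, and the degrees above J2
    are (q^n - 1) times a power of 2 (deg_J2).  The same argument for Z and K
    shows that the degrees above the nontrivial members of J1 are prime to m
    and to d (deg_J1).  On Z itself, G does have larger orbits than N
    (classG_in), hence also on Irr Z, and the degrees above such an orbit are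
    divisible by 3 (exists_deg_dvd3), and by 2 because the linear characters of
    P are trivial on Z (p_dvd_deg_nker).

    So 3 is adjacent to 2, the primes of m have no neighbour in pi1 and those
    of d none in pi0: the diameter is 3, alpha is the set of the a primes of m,
    and delta contains the primes of d.  The primes of m have to be prime to
    q^n - 1; divisors of numbers 2^s + 1 are, because f n is odd
    (exists_odd_order_free).  Replacing f by 5 f multiplies q^2 + q + 1 by a
    coprime factor, so d can have as many primes as wanted
    (exists_many_primes). *)

Set Implicit Arguments.
Unset Strict Implicit.
Unset Printing Implicit Defensive.

Import GroupScope GRing.Theory Num.Theory.
Local Open Scope ring_scope.
Local Open Scope nat_scope.
Local Open Scope group_scope.

(** * Orbits of two groups with the same fixed point counts *)
Section Orbits.

Variables (aT : finGroupType) (D : {group aT}).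
Variables (H G : {group aT}) (sHG : H \subset G).

(** Each G-orbit is a union of H-orbits, so equally many orbits leave no room
    for a union of two. *)
Lemma orbit_eq_of_card (T : finType) (to : action D T) (S : {set T}) :
    [acts G, on S | to] ->
    #|orbit to G @: S| = #|orbit to H @: S| ->
  {in S, forall x, orbit to G x = orbit to H x}.
Proof.
move=> actS eq_card x Sx; have sGD := acts_dom actS.
have sHD := subset_trans sHG sGD.
pose f (X : {set T}) := \bigcup_(z in X) orbit to G z.
have fE z : f (orbit to H z) = orbit to G z.
  apply/setP=> u; apply/bigcupP/idP=> [[w /orbitP[h Hh <-]]|Gu].
    by rewrite orbit_in_sym // orbit_actr_in ?(subsetP sHG) // orbit_in_sym.
  by exists z => //; apply: orbit_refl.
have f_im : f @: (orbit to H @: S) = orbit to G @: S.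
  by rewrite -imset_comp; apply: eq_imset => z /=; rewrite fE.
have /imset_injP f_inj : #|f @: (orbit to H @: S)| == #|orbit to H @: S|.
  by rewrite f_im eq_card.
apply/eqP; rewrite eqEsubset; apply/andP; split; last exact: imsetS.
apply/subsetP=> y Gxy; have Sy : y \in S.
  by apply: (subsetP _ _ Gxy); rewrite (acts_sub_orbit _ actS).
apply/orbit_in_eqP=> //; apply: f_inj; rewrite ?imset_f // !fE.
exact/orbit_in_eqP.
Qed.

(** By the Cauchy-Frobenius formula the number of orbits of a subgroup only
    depends on how many points each of its elements fixes. *)
Lemma orbit_eq_transfer (T1 T2 : finType) (to1 : action D T1)
    (to2 : action D T2) (S1 : {set T1}) (S2 : {set T2}) :
    [acts G, on S1 | to1] -> [acts G, on S2 | to2] ->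
    {in G, forall a, #|'Fix_(S1 | to1)[a]| = #|'Fix_(S2 | to2)[a]|} ->
    {in S2, forall x, orbit to2 G x = orbit to2 H x} ->
  {in S1, forall x, orbit to1 G x = orbit to1 H x}.
Proof.
move=> act1 act2 eqFix eqOrb; apply: orbit_eq_of_card => //.
have card_orb (K : {group aT}) : K \subset G ->
    #|orbit to1 K @: S1| = #|orbit to2 K @: S2|.
  move=> sKG; apply/eqP; rewrite -(eqn_pmul2r (cardG_gt0 K)).
  rewrite -!Frobenius_Cauchy ?(subset_trans sKG) //; apply/eqP.
  by apply: eq_bigr => a Ka; apply: eqFix; apply: (subsetP sKG).
by rewrite !card_orb // (eq_in_imset eqOrb).
Qed.

End Orbits.

(** * The action on irreducible characters and on classes *)
Section IrrAction.

Variables (gT : finGroupType) (P G : {group gT}).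
Hypothesis nsPG : P <| G.

Lemma conjg_Iirr_is_action : is_action G (@conjg_Iirr _ P).
Proof.
split=> [y j k eq_jk | j y z Gy Gz].
  by apply/irr_inj/(can_inj (cfConjgK y)); rewrite -!conjg_IirrE eq_jk.
by apply: irr_inj; rewrite !conjg_IirrE (cfConjgM _ nsPG).
Qed.

Definition irr_act := Action conjg_Iirr_is_action.
Definition class_act := ('Js \ subsetT G)%act.

Lemma acts_classes : [acts G, on classes P | class_act].
Proof.
have nPG := normal_norm nsPG; rewrite astabs_ract subsetIidl.
apply/subsetP=> y Gy; have nPy := subsetP nPG y Gy.
rewrite !inE; apply/subsetP=> _ /imsetP[z Gz ->] /[!inE]/=.
rewrite -class_rcoset norm_rlcoset // class_lcoset.
by apply: imset_f; rewrite memJ_norm.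
Qed.

(** Brauer's permutation lemma. *)
Lemma card_fix_irr g : g \in G ->
  #|'Fix_irr_act[g]| = #|'Fix_(classes P | class_act)[g]|.
Proof.
move=> Gg; have nPg := subsetP (normal_norm nsPG) g Gg.
apply: card_afix_irr_classes => // [|j y _ Py /imsetP[_ /imsetP[z Pz ->] ->]].
  exact: acts_classes.
by rewrite conjg_IirrE cfConjgEJ // cfunJ.
Qed.

Lemma fix_irrE g i : g \in G -> (i \in 'Fix_irr_act[g]) = (g \in 'I['chi_i]).
Proof.
move=> Gg; have nPg := subsetP (normal_norm nsPG) g Gg.
apply/afix1P/setIdP=> [/= fix_i | [_ /eqP fix_i]].
  by rewrite -conjg_IirrE fix_i.
by apply: irr_inj; rewrite conjg_IirrE.
Qed.

Lemma acts_irr_setT : [acts G, on [set: Iirr P] | irr_act].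
Proof.
apply/subsetP=> g Gg; rewrite !inE Gg; apply/subsetP=> i; by rewrite !inE.
Qed.

Lemma card_orbit_irr (K : {group gT}) i : P \subset K -> K \subset G ->
  #|orbit irr_act K i| = #|K : 'I_K['chi_i]|.
Proof.
by move=> sPK sKG; rewrite -card_cfclass_Iirr // (normalS sPK sKG nsPG).
Qed.

Lemma classJ x g : g \in G -> (x ^: P) :^ g = (x ^ g) ^: P.
Proof.
move=> Gg; have nPg := subsetP (normal_norm nsPG) g Gg.
by rewrite -class_rcoset norm_rlcoset // class_lcoset.
Qed.

Lemma orbit_class_eq (N K : {group gT}) x : N \subset K -> K \subset G ->
    x ^: K \subset x ^: N ->
  orbit class_act K (x ^: P) = orbit class_act N (x ^: P).
Proof.
move=> sNK sKG sxKN; apply/eqP; rewrite eqEsubset andbC imsetS //=.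
apply/subsetP=> _ /imsetP[g Kg ->] /=.
have /imsetP[h Nh def_h] := subsetP sxKN _ (memJ_class x Kg).
apply/imsetP; exists h => //=.
have Kh := subsetP sNK h Nh.
by rewrite !classJ ?def_h // (subsetP sKG).
Qed.

Lemma class_orbit_eq (N : {group gT}) x : P \subset N -> N \subset G ->
    orbit class_act G (x ^: P) = orbit class_act N (x ^: P) ->
  x ^: G \subset x ^: N.
Proof.
move=> sPN sNG eqO; apply/subsetP=> _ /imsetP[g Gg ->].
have: (x ^ g) ^: P \in orbit class_act G (x ^: P).
  by apply/imsetP; exists g; rewrite //= classJ.
rewrite eqO => /imsetP[h Nh /= def_h].
have: x ^ g \in (x ^: P) :^ h by rewrite -def_h class_refl.
rewrite classJ ?(subsetP sNG) // => /imsetP[y Py ->].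
by rewrite -conjgM memJ_class // groupM // (subsetP sPN).
Qed.

End IrrAction.

(** * Degrees and Clifford theory *)
Section Degree.

Variables (gT : finGroupType) (G : {group gT}).

Definition deg (i : Iirr G) := Num.truncn ('chi_i 1%g).

Lemma degE (i : Iirr G) : 'chi_i 1%g = (deg i)%:R :> algC.
Proof. by rewrite /deg irr1_degree truncnK ?natr_nat. Qed.

Lemma deg_gt0 (i : Iirr G) : 0 < deg i.
Proof. by rewrite -(ltr_nat algC) -degE irr1_gt0. Qed.

Lemma deg_dvdG (i : Iirr G) : deg i %| #|G|.
Proof. by have := dvd_irr1_cardG i; rewrite degE dvdC_nat. Qed.

Lemma deg_abelian (i : Iirr G) : abelian G -> deg i = 1%N.
Proof.
move/char_abelianP=> /(_ i) /andP[_ /eqP chi1].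
by apply/eqP; rewrite -(eqr_nat algC) -degE chi1.
Qed.

End Degree.

Section DegreeOverSubgroup.

Variable gT : finGroupType.
Implicit Types G P N : {group gT}.

(** By Frobenius reciprocity 'chi_i is a constituent of a character of degree
    #|G : A|, induced from a linear character of A. *)
Lemma deg_le_index G (A : {group gT}) (i : Iirr G) :
  A \subset G -> abelian A -> deg i <= #|G : A|.
Proof.
move=> sAG abA; have [j iAj] := constt_cfRes_irr A i.
rewrite -(ler_nat algC) -degE.
pose phi := ('Ind[G] 'chi_j)%R.
rewrite (Order.POrderTheory.le_trans (char1_ge_constt (chi := phi) _ _)) //.
- by rewrite cfInd_char ?irr_char.
- by rewrite constt_Ind_Res.
by rewrite cfInd1 // degE deg_abelian ?mulr1.
Qed.

(** By Clifford's theorem the restriction is a multiple of the sum of the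
    #|G : 'I_G['chi_j]| conjugates of 'chi_j. *)
Lemma dvd_deg_constt G P (i : Iirr G) (j : Iirr P) :
    P <| G -> j \in irr_constt ('Res[P] 'chi_i) ->
  exists e, deg i = (e * (#|G : 'I_G['chi_j]| * deg j))%N.
Proof.
move=> nsPG iPj; have sPG := normal_sub nsPG.
have /natrP[e De]: '['Res[P] 'chi_i, 'chi_j] \in Num.nat.
  by rewrite Cnat_cfdot_char ?cfRes_char ?irr_char.
exists e; apply/eqP; rewrite -(eqr_nat algC) -degE -(cfResE _ sPG) //.
rewrite {1}(Clifford_Res_sum_cfclass nsPG iPj) cfunE sum_cfunE De.
rewrite !natrM -degE -size_cfclass; apply/eqP; congr (_ * _)%R.
rewrite mulr_natl -[size _]card_ord big_tnth -sumr_const; apply: eq_bigr => k _.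
by have /cfclassP[y Gy ->]:=  mem_tnth k (in_tuple _); rewrite cfConjg1.
Qed.

(** The Clifford correspondence reduces to the inertia group, to which 'chi_j
    extends because its order is prime to the index; the characters above an
    extendible character are its products with those of the quotient. *)
Lemma deg_Clifford_coprime G P (i : Iirr G) (j : Iirr P) :
    P <| G -> solvable (G / P) -> coprime #|P| #|G : P| ->
    j \in irr_constt ('Res[P] 'chi_i) ->
  exists k : Iirr ('I_G['chi_j] / P)%G,
    deg i = (#|G : 'I_G['chi_j]| * deg j * deg k)%N.
Proof.
move=> nsPG solGP coPG iPj; have sPG := normal_sub nsPG.
set I := 'I_G['chi_j]%G; have sIG : I \subset G := Inertia_sub _ _.
have nsPI : P <| I by apply: normal_Inertia.
have [_ _ AB _ _] := constt_Inertia_bijection j nsPG.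
have: i \in irr_constt ('Ind[G] 'chi_j) by rewrite constt_Ind_Res.
rewrite -AB => /imsetP[s]; rewrite constt_Ind_Res => Ij def_i.
have irr_s : 'Ind[G] 'chi_s \in irr G.
  have [irrA _ _ _ _] := constt_Inertia_bijection j nsPG.
  by apply: irrA; rewrite constt_Ind_Res.
have deg_i : deg i = (#|G : I| * deg s)%N.
  apply/eqP; rewrite -(eqr_nat algC) -degE def_i cfIirrE //.
  by rewrite cfInd1 // natrM degE.
have coPI : coprime #|I : P| #|P|.
  rewrite coprime_sym (coprime_dvdr _ coPG) //.
  by rewrite -(Lagrange_index sIG (normal_sub nsPI)) dvdn_mull.
have [||| c [cj _ _]] := @extend_solvable_coprime_irr _ I P j nsPI.
- by rewrite (solvableS _ solGP) // quotientS.
- exact: subsetIr.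
- rewrite coprimeMr.
  rewrite (coprime_dvdr _ coPI) ?(coprime_dvdr (deg_dvdG j) coPI) //.
  exact: cfDet_order_dvdG.
have [_ _ ext _] := constt_Ind_ext nsPI cj.
have := ext s; rewrite constt_Ind_Res Ij => /esym/codomP[k def_s].
exists k; rewrite deg_i -mulnA; congr (_ * _)%N.
have [irr_k _ _ _] := constt_Ind_ext nsPI cj.
apply/eqP; rewrite -(eqr_nat algC) -degE def_s cfIirrE ?irr_k // cfunE.
rewrite mod_IirrE // cfMod1 degE natrM mulrC; apply/eqP; congr (_ * _)%R.
  by rewrite -!degE -cj cfRes1.
exact: degE.
Qed.

End DegreeOverSubgroup.

(** * Restriction to a central subgroup *)
Section CentralRestriction.

Variables (gT : finGroupType) (Z Q : {group gT}).
Hypotheses (sZQ : Z \subset Q) (cZQ : Q \subset 'C(Z)).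

Lemma central_normal : Z <| Q.
Proof. by rewrite /normal sZQ cents_norm. Qed.

Lemma central_abelian : abelian Z.
Proof. exact: subset_trans sZQ cZQ. Qed.

(** A character of the central subgroup Z is its own only conjugate, and it is
    linear. *)
Lemma Res_central (i : Iirr Q) (j : Iirr Z) :
    j \in irr_constt ('Res[Z] 'chi_i) ->
  'Res[Z] 'chi_i = ('chi_i 1%g *: 'chi_j)%R.
Proof.
move=> iZj; have := Clifford_Res_sum_cfclass central_normal iZj.
rewrite cfclass_invariant ?(subset_trans cZQ) ?cent_sub_inertia // big_seq1.
move=> def_i; rewrite {1}def_i; congr (_ *: _)%R.
have /(congr1 (fun phi : 'CF(Z) => phi 1%g)) := def_i.
rewrite cfRes1 cfunE => ->.
by rewrite (degE j) deg_abelian ?central_abelian // mulr1.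
Qed.

Lemma constt_Res_central (i : Iirr Q) (j k : Iirr Z) :
    j \in irr_constt ('Res[Z] 'chi_i) -> k \in irr_constt ('Res[Z] 'chi_i) ->
  j = k.
Proof.
move=> /Res_central->; rewrite irr_consttE cfdotZl cfdot_irr.
by case: (j =P k) => // _; rewrite mulr0 eqxx.
Qed.

Definition central_Iirr (i : Iirr Q) : Iirr Z := sval (constt_cfRes_irr Z i).

Lemma central_IirrP i : central_Iirr i \in irr_constt ('Res[Z] 'chi_i).
Proof. by rewrite /central_Iirr; case: constt_cfRes_irr. Qed.

Lemma central_Iirr_eq i j :
  j \in irr_constt ('Res[Z] 'chi_i) -> central_Iirr i = j.
Proof. exact: constt_Res_central (central_IirrP i). Qed.

Lemma central_Iirr0 : central_Iirr 0%R = 0%R.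
Proof.
apply: central_Iirr_eq.
by rewrite !irr0 cfRes_cfun1 // -irr0 constt_irr inE.
Qed.

Lemma central_IirrJ (G : {group gT}) i g : Z <| G -> Q <| G -> g \in G ->
  central_Iirr (conjg_Iirr i g) = conjg_Iirr (central_Iirr i) g.
Proof.
move=> nsZG nsQG Gg; apply: central_Iirr_eq.
rewrite irr_consttE !conjg_IirrE -(cfConjgRes _ nsQG nsZG) // cfConjg_iso.
exact: central_IirrP.
Qed.

End CentralRestriction.

Lemma constt_Res_cfker (gT : finGroupType) (G H : {group gT}) (i : Iirr G) j :
  H \subset cfker 'chi_i -> j \in irr_constt ('Res[H] 'chi_i) -> j = 0%R.
Proof.
move=> kerH; rewrite irr_consttE cfRes_sub_ker // -irr0 cfdotZl cfdot_irr.
by case: (0%R =P j) => // _; rewrite mulr0 eqxx.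
Qed.

Lemma class_central (gT : finGroupType) (A Z : {group gT}) z :
  A \subset 'C(Z) -> z \in Z -> z ^: A = [set z].
Proof.
move=> cZA Zz; apply/setP=> u; rewrite inE; apply/imsetP/eqP=> [[a Aa ->]|->].
  by rewrite conjgE -(centP (subsetP cZA a Aa) z Zz) mulKg.
by exists 1; rewrite ?conjg1.
Qed.

(** * Characters in a regular orbit of a complement *)
Section RegularOrbit.

Variables (gT : finGroupType) (C S H : {group gT}).
Hypotheses (sdH : C ><| S = H) (abC : abelian C).
Hypothesis few_fixed : \sum_(s in S^#) #|'C_C[s]| < #|C|.

(** Some linear character of C is fixed by no element of S other than 1, since
    such an element s fixes only #|'C_C[s]| of them; its inertia group in H is
    C. *)
Lemma exists_deg_index : exists i : Iirr H, #|S| %| deg i.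
Proof.
have [nsCH sSH defH nCS tiCS] := sdprod_context sdH.
have sCH := normal_sub nsCH; set ito := irr_act nsCH.
have fixE s : s \in S^# -> #|'Fix_ito[s]| <= #|'C_C[s]|.
  case/setD1P=> _ Ss; rewrite card_fix_irr ?(subsetP sSH) //.
  rewrite -(card_imset _ (@set1_inj gT)) subset_leq_card //.
  apply/subsetP=> _ /setIP[/imsetP[x Cx ->] /afix1P /=].
  have -> : x ^: C = [set x] by apply: (class_central (Z := C)).
  rewrite conjg_set1 => /set1_inj fix_x; apply: imset_f.
  by rewrite inE Cx; apply/cent1P/commgP/conjg_fixP.
have [l nfix_l] : exists l : Iirr C, [forall s in S^#, l \notin 'Fix_ito[s]].
  apply/existsP; apply: contraLR few_fixed => /existsPn fixed.
  rewrite -leqNgt -(card_Iirr_abelian abC) -cardsT.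
  have leF : \sum_(s in S^#) #|'Fix_ito[s]| <= \sum_(s in S^#) #|'C_C[s]|.
    exact: leq_sum.
  apply: leq_trans leF.
  apply: (@leq_trans #|\bigcup_(s in S^#) 'Fix_ito[s]|).
    apply/subset_leq_card/subsetP=> l _; have := fixed l.
    rewrite negb_forall_in => /exists_inP[s Ss]; rewrite negbK => fix_l.
    by apply/bigcupP; exists s.
  elim/big_rec2: _ => [|s m U _ leUm]; first by rewrite cards0.
  by rewrite (leq_trans _ (leq_add (leqnn _) leUm)) // cardsU leq_subr.
have inertia_l : 'I_H['chi_l] = C.
  apply/eqP; rewrite eqEsubset sub_Inertia // andbT -{1}defH.
  rewrite -group_modl ?sub_inertia // mul_subG //.
  apply/subsetP=> s /setIP[Ss Is].
  apply: contraT => C's; have nts : s != 1 by apply: contra C's => /eqP->.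
  have /forall_inP/(_ s) := nfix_l; rewrite in_setD1 nts Ss => /(_ isT).
  by rewrite fix_irrE ?Is ?(subsetP sSH).
have [i li] := constt_cfInd_irr l sCH; rewrite constt_Ind_Res in li.
exists i; have [e ->] := dvd_deg_constt nsCH li; rewrite inertia_l.
suffices -> : #|S| = #|H : C| by rewrite mulnCA dvdn_mulr.
apply/eqP; rewrite -(eqn_pmul2l (cardG_gt0 C)) Lagrange //.
by rewrite -(sdprod_card sdH).
Qed.

End RegularOrbit.

Lemma exists_deg_sdprod (gT : finGroupType) (P H G : {group gT}) (i : Iirr H) :
  P ><| H = G -> exists2 j : Iirr G, deg j = deg i & P \subset cfker 'chi_j.
Proof.
move=> sdG; exists (sdprod_Iirr sdG i); last by rewrite sdprod_IirrE cfker_sdprod.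
by rewrite /deg sdprod_IirrE cfSdprod1.
Qed.

(** * Graphs made of two cliques *)
Section Distances.

Variable e : rel nat.

Lemma is_distance0 x : is_distance e x x 0.
Proof. by split=> //; exists [::]; rewrite // /walk /= eqxx. Qed.

Lemma is_distance1 x y : x != y -> e x y -> is_distance e x y 1.
Proof.
move=> neq_xy exy; split; first by exists [:: y]; rewrite // /walk /= exy eqxx.
by case=> // /andP[_ /= /eqP xy]; rewrite xy eqxx in neq_xy.
Qed.

Lemma is_distance2 x y z :
  x != y -> ~~ e x y -> e x z -> e z y -> is_distance e x y 2.
Proof.
move=> neq_xy nexy exz ezy; split.
  by exists [:: z; y]; rewrite // /walk /= exz ezy eqxx.
case=> [|u [|v s]] //.
  by move=> /andP[_ /= /eqP xy]; rewrite xy eqxx in neq_xy.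
by rewrite /walk /= andbT => /andP[exu /eqP uy]; rewrite -uy exu in nexy.
Qed.

Lemma is_distance3 x y z t : x != y -> ~~ e x y ->
    (forall u, e x u -> ~~ e u y) -> e x z -> e z t -> e t y ->
  is_distance e x y 3.
Proof.
move=> neq_xy nexy no2 exz ezt ety; split.
  by exists [:: z; t; y]; rewrite // /walk /= exz ezt ety eqxx.
case=> [|u [|v [|w s]]] //.
  by move=> /andP[_ /= /eqP xy]; rewrite xy eqxx in neq_xy.
  by rewrite /walk /= andbT => /andP[exu /eqP uy]; rewrite -uy exu in nexy.
rewrite /walk /= andbT => /andP[/andP[exu euv] /eqP vy].
by have := no2 u exu; rewrite -vy euv.
Qed.

(** If the distance exceeds 2, then x is not a0 and y is not b0, and x, a0, b0,
    y is a walk. *)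
Lemma distance_le3 (A B V : {fset nat}) x y a0 b0 :
    (forall u v, e u v -> v \in V) ->
    (forall u v, u \in A -> v \in A -> u != v -> e u v) ->
    (forall u v, u \in B -> v \in B -> u != v -> e u v) ->
    a0 \in A -> b0 \in B -> e a0 b0 -> x \in A -> y \in B ->
  exists2 m, is_distance e x y m & m <= 3.
Proof.
move=> eV cliqueA cliqueB Aa0 Bb0 e0 Ax By.
have [<-|neq_xy] := eqVneq x y; first by exists 0; [apply: is_distance0|].
have [exy|nexy] := boolP (e x y); first by exists 1%N; [apply: is_distance1|].
have [/hasP[z _ /andP[exz ezy]]|/hasPn no2] :=
  boolP (has (fun z => e x z && e z y) V).
  by exists 2; [apply: is_distance2 exz ezy|].
have no2' u : e x u -> ~~ e u y.
  by move=> exu; have := no2 u (eV _ _ exu); rewrite exu.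
have neq_xa : x != a0.
  apply/eqP=> def_x; have exb : e x b0 by rewrite def_x.
  have neq_by : b0 != y by apply: contraNneq nexy => <-.
  by have /negP[] := no2' b0 exb; apply: cliqueB.
have exa := cliqueA _ _ Ax Aa0 neq_xa.
have neq_by : b0 != y.
  by apply/eqP=> def_b; have /negP[] := no2' a0 exa; rewrite -def_b.
exists 3 => //; apply: (@is_distance3 _ _ a0 b0) => //.
exact: cliqueB.
Qed.

End Distances.

Section TwoCliques.

Local Open Scope fset_scope.

Variables (A B : {fset nat}) (e : rel nat).
Hypothesis syme : symmetric e.
Hypothesis eV : forall x y, e x y -> y \in A `|` B.
Hypothesis cliqueA : forall x y, x \in A -> y \in A -> x != y -> e x y.
Hypothesis cliqueB : forall x y, x \in B -> y \in B -> x != y -> e x y.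

Lemma has_diameter3 a0 b0 a1 b1 :
    a0 \in A -> b0 \in B -> e a0 b0 -> a1 \in A -> b1 \in B -> a1 != b1 ->
    (forall y, y \in B -> ~~ e a1 y) -> (forall x, x \in A -> ~~ e x b1) ->
  has_diameter (A `|` B) e 3.
Proof.
move=> Aa0 Bb0 e0 Aa1 Bb1 neq1 isol_a isol_b; split=> [x y|].
  have near (C : {fset nat}) u v :
      (forall u v, u \in C -> v \in C -> u != v -> e u v) ->
      u \in C -> v \in C -> exists2 m, is_distance e u v m & m <= 3.
    move=> cliqueC Cu Cv; have [<-|neq_uv] := eqVneq u v.
      by exists 0; [apply: is_distance0|].
    by exists 1%N; [apply: is_distance1; rewrite ?cliqueC|].
  case/fsetUP=> Cx /fsetUP[]Cy;
    [exact: (near A _ _ cliqueA)| | |exact: (near B _ _ cliqueB)].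
    exact: (distance_le3 eV cliqueA cliqueB Aa0 Bb0).
  by apply: (distance_le3 eV cliqueB cliqueA Bb0 Aa0); rewrite // syme.
exists a1, b1; split; rewrite ?in_fsetU ?Aa1 ?Bb1 ?orbT //.
have neq_a : a1 != a0 by apply: contraTneq e0 => <-; apply: isol_a.
have neq_b : b0 != b1 by apply: contraTneq e0 => ->; apply: isol_b.
have e1a := cliqueA Aa1 Aa0 neq_a; have eb1 := cliqueB Bb0 Bb1 neq_b.
apply: (is_distance3 neq1 (isol_a _ Bb1) _ e1a e0 eb1) => u e1u.
case/fsetUP: (eV e1u) => [Au|Bu]; first exact: isol_b.
by rewrite (negbTE (isol_a u Bu)) in e1u.
Qed.

Lemma component_two_cliques C a0 b0 :
    a0 \in A -> b0 \in B -> (forall x y, x \in A -> y \in B -> ~~ e x y) ->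
  is_component (A `|` B) e C <-> C = A \/ C = B.
Proof.
move=> Aa0 Bb0 noAB.
have walkA x s : x \in A -> path e x s -> last x s \in A.
  elim: s x => //= y s IHs x Ax /andP[exy]; apply: IHs.
  by case/fsetUP: (eV exy) => // By; rewrite (negbTE (noAB x y Ax By)) in exy.
have walkB x s : x \in B -> path e x s -> last x s \in B.
  elim: s x => //= y s IHs x Bx /andP[exy]; apply: IHs.
  by case/fsetUP: (eV exy) => // Ay; rewrite syme (negbTE (noAB y x Ay Bx)) in exy.
have conn (D : {fset nat}) x y :
    (forall u v, u \in D -> v \in D -> u != v -> e u v) ->
    x \in D -> y \in D -> connected e x y.
  move=> cliqueD Dx Dy; have [<-|neq_xy] := eqVneq x y.
    by exists [::]; rewrite /walk /= eqxx.
  by exists [:: y]; rewrite /walk /= cliqueD // eqxx.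
have compA x y : x \in A -> y \in A <-> y \in A `|` B /\ connected e x y.
  move=> Ax; split=> [Ay|[_ [s /andP[es /eqP <-]]]]; last exact: walkA.
  by rewrite in_fsetU Ay; split=> //; apply: (conn A).
have compB x y : x \in B -> y \in B <-> y \in A `|` B /\ connected e x y.
  move=> Bx; split=> [By|[_ [s /andP[es /eqP <-]]]]; last exact: walkB.
  by rewrite in_fsetU By orbT; split=> //; apply: (conn B).
split=> [[x /fsetUP[Ax|Bx] compC]|[->|->]].
- left; apply/fsetP=> y.
  by apply/idP/idP=> [/compC/(compA x y Ax)|/(compA x y Ax)/compC].
- right; apply/fsetP=> y.
  by apply/idP/idP=> [/compC/(compB x y Bx)|/(compB x y Bx)/compC].
- by exists a0; [rewrite in_fsetU Aa0 | move=> y; apply: compA].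
by exists b0; [rewrite in_fsetU Bb0 orbT | move=> y; apply: compB].
Qed.

End TwoCliques.

(** * The character degree graph *)
Section DegreeSet.

Variables (gT : finGroupType) (G : {group gT}).

Lemma cdP d : reflect (exists i : Iirr G, d = deg i) (d \in cd G).
Proof.
apply: (iffP idP) => [/imfsetP[i _ ->]|[i ->]]; first by exists i.
by apply/imfsetP; exists i.
Qed.

Lemma cd_gt0 d : d \in cd G -> 0 < d.
Proof. by case/cdP=> i ->; apply: deg_gt0. Qed.

Lemma verticesP q :
  reflect (exists2 d, d \in cd G & q \in primes d) (q \in vertices G).
Proof.
apply: (iffP idP) => [/imfsetP[r /= /flattenP[_ /mapP[d cd_d ->]] qd ->]|].
  by exists d.
case=> d cd_d qd.
apply/imfsetP; exists q => //=; apply/flattenP; exists (primes d) => //.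
exact: map_f.
Qed.

Lemma adjacentP q r : prime q -> prime r -> q != r ->
  reflect (exists d, [/\ d \in cd G, q %| d & r %| d]) (adjacent G q r).
Proof.
move=> pr_q pr_r neq_qr.
have co_qr : coprime q r by rewrite prime_coprime // dvdn_prime2.
apply: (iffP and4P) => [[_ _ _ /hasP[d cd_d]]|[d [cd_d qd rd]]].
  by rewrite Gauss_dvd // => /andP[qd rd]; exists d.
have d_gt0 := cd_gt0 cd_d.
have V s : prime s -> s %| d -> s \in vertices G.
  by move=> pr_s sd; apply/verticesP; exists d; rewrite // mem_primes pr_s d_gt0.
split; rewrite ?V //; apply/hasP; exists d => //.
by rewrite Gauss_dvd // qd.
Qed.

Lemma adjacent_sym : symmetric (adjacent G).
Proof.
by move=> q r; rewrite /adjacent eq_sym mulnC andbCA.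
Qed.

End DegreeSet.

Lemma cd_quotientP (gT : finGroupType) (G N : {group gT}) d : N <| G ->
  reflect (exists2 i : Iirr G, N \subset cfker 'chi_i & d = deg i)
          (d \in cd (G / N)%G).
Proof.
move=> nsNG; apply: (iffP idP) => [/cdP[i ->]|[i kerN ->]].
  exists (mod_Iirr i); first by rewrite mod_IirrE // cfker_mod.
  by rewrite /deg mod_IirrE // cfMod1.
apply/cdP; exists (quo_Iirr N i).
by rewrite /deg quo_IirrE // cfQuo1.
Qed.

Section CliqueVertices.

Local Open Scope fset_scope.

Variables (gT : finGroupType) (G : {group gT}) (a b : nat).
Hypothesis cd_ab : forall d q, d \in cd G -> prime q -> q %| d ->
  (q \in primes a) || (q \in primes b).
Hypothesis cd_a : exists2 d, d \in cd G & a %| d.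
Hypothesis cd_b : exists2 d, d \in cd G & b %| d.

Local Notation A := [fset q in primes a].
Local Notation B := [fset q in primes b].

Lemma primes_dvd_cd m q : (exists2 d, d \in cd G & m %| d) -> q \in primes m ->
  exists2 d, d \in cd G & (prime q) && (q %| d).
Proof.
case=> d cd_d md; rewrite mem_primes => /and3P[pr_q _ qm]; exists d => //.
by rewrite pr_q (dvdn_trans qm).
Qed.

Lemma clique_vertices : vertices G = A `|` B.
Proof.
have inP m q : (q \in [fset r in primes m]) = (q \in primes m) by rewrite inE.
apply/fsetP=> q; rewrite in_fsetU !inP; apply/verticesP/idP=> [[d cd_d]|].
  by rewrite mem_primes => /and3P[pr_q _ qd]; apply: cd_ab qd.
case/orP=> [/(primes_dvd_cd cd_a)|/(primes_dvd_cd cd_b)] [d cd_d /andP[pr_q qd]];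
  by exists d; rewrite // mem_primes pr_q qd (cd_gt0 cd_d).
Qed.

Lemma clique_adjacent m q r : (exists2 d, d \in cd G & m %| d) ->
    q \in [fset q in primes m] -> r \in [fset q in primes m] -> q != r ->
  adjacent G q r.
Proof.
case=> d cd_d md; rewrite !inE /= !mem_primes.
move=> /and3P[pr_q _ qm] /and3P[pr_r _ rm] neq.
by apply/adjacentP=> //; exists d; split=> //; apply: dvdn_trans md.
Qed.

Lemma adjacent_vertices q r : adjacent G q r -> r \in A `|` B.
Proof. by case/and4P=> _; rewrite clique_vertices. Qed.

End CliqueVertices.

(** * Degrees from the fixed points of a group of operators *)

(** Here Z, P, M, N, K and G stand for the groups with these names in the
    introduction, and c for a generator of C0; they only enter through their
    conjugacy classes and centralizers. *)
Section Core.

Variables (gT : finGroupType) (Z P M N K G : {group gT}) (c : gT).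
Hypotheses (nsZG : Z <| G) (nsPG : P <| G) (nsMG : M <| G).
Hypotheses (nsNG : N <| G) (nsKG : K <| G).
Hypotheses (sZP : Z \subset P) (sMN : M \subset N) (sNK : N \subset K).
Hypotheses (sdM : P ><| <[c]> = M) (ntc : c != 1).
Hypothesis cZM : M \subset 'C(Z).
Hypothesis centN_out : {in P :\: Z, forall x, 'C_N[x] \subset P}.
Hypothesis centN_in : {in Z^#, forall z, 'C_N[z] \subset M}.
Hypothesis coPG : coprime #|P| #|G : P|.

Let sPM : P \subset M. Proof. by case/sdprod_context: sdM => /andP[]. Qed.
Let sPN : P \subset N. Proof. exact: subset_trans sPM sMN. Qed.
Let sNG : N \subset G. Proof. exact: normal_sub. Qed.
Let sKG : K \subset G. Proof. exact: normal_sub. Qed.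
Let sMG : M \subset G. Proof. exact: subset_trans sMN sNG. Qed.
Let cZP : P \subset 'C(Z). Proof. exact: subset_trans sPM cZM. Qed.
Let cZZ : Z \subset 'C(Z). Proof. exact: subset_trans sZP cZP. Qed.
Let Mc : c \in M.
Proof. by case/sdprod_context: sdM => _ + _ _ _; rewrite cycle_subG. Qed.
Let Pc' : c \notin P.
Proof.
case/sdprod_context: sdM => _ _ _ _ tiPc; apply: contra ntc => Pc.
by rewrite -in_set1 -[[set 1]]/(1 : {set gT}) -tiPc inE Pc cycle_id.
Qed.

Local Notation ito := (irr_act nsPG).
Local Notation jto := (irr_act nsZG).
Local Notation cto := (class_act G).

Lemma classes_central : classes Z \subset classes P.
Proof.
apply/subsetP=> _ /imsetP[z Zz ->].
rewrite (class_central cZZ) // -(class_central cZP Zz) mem_classes //.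
exact: subsetP Zz.
Qed.

(** If g maps x to an element x ^ y of the class of x, then g * y^-1
    centralizes x and lies outside P, so that x is in Z. *)
Lemma fix_classes_out g : g \in N :\: P ->
  'Fix_(classes P | class_act G)[g] \subset classes Z.
Proof.
case/setDP=> Ng P'g; apply/subsetP=> _ /setIP[/imsetP[x Px ->] /afix1P /= xg].
have: x ^ g \in x ^: P by rewrite -xg memJ_conjg class_refl.
case/imsetP=> y Py xgy; have [Zx | Z'x] := boolP (x \in Z).
  by rewrite (class_central cZP) // -(class_central cZZ Zx) mem_classes.
have: g * y^-1 \in 'C_N[x].
  rewrite inE groupM ?groupV ?(subsetP sPN y) //=.
  by rewrite cent1C; apply/cent1P/commgP/conjg_fixP; rewrite conjgM xgy conjgK.
move/(subsetP (centN_out _)); rewrite inE Z'x Px => /(_ isT).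
by rewrite groupMr ?groupV // (negbTE P'g).
Qed.

Lemma card_classesZ : #|classes Z| = #|Z|.
Proof. by apply/eqP; rewrite -card_classes_abelian; apply: cZZ. Qed.

(** As <[c]> complements P in M, these are the characters invariant in M. *)
Definition J1 := 'Fix_ito[c].

Lemma J1P i : reflect (M \subset 'I['chi_i]) (i \in J1).
Proof.
rewrite fix_irrE ?(subsetP sMG) //; apply: (iffP idP) => [Ic | /subsetP-> //].
by case/sdprodP: sdM => _ <- _ _; rewrite mul_subG ?sub_inertia ?cycle_subG.
Qed.

Lemma fix_classes_M g : g \in M :\: P ->
  'Fix_(classes P | class_act G)[g] = classes Z.
Proof.
case/setDP=> Mg P'g; apply/eqP; rewrite eqEsubset fix_classes_out; last first.
  by rewrite inE P'g (subsetP sMN).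
rewrite subsetI classes_central; apply/subsetP=> _ /imsetP[z Zz ->].
apply/afix1P; rewrite /= (class_central cZZ) //.
by rewrite conjg_set1 conjgE -(centP (subsetP cZM g Mg) z Zz) mulKg.
Qed.

Lemma card_J1 : #|J1| = #|Z|.
Proof.
by rewrite card_fix_irr ?fix_classes_M ?card_classesZ ?inE ?Pc' ?(subsetP sMG).
Qed.

(** Each element of M outside P fixes all of J1, and #|Z| characters by Brauer's
    lemma. *)
Lemma fix_irr_M g : g \in M :\: P -> 'Fix_ito[g] = J1.
Proof.
move=> MPg; have /setDP[Mg _] := MPg; apply/esym/eqP.
rewrite eqEcard card_J1 card_fix_irr ?(subsetP sMG) // fix_classes_M //.
rewrite card_classesZ leqnn andbT; apply/subsetP=> i /J1P/subsetP sMI.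
by rewrite fix_irrE ?(subsetP sMG) ?sMI.
Qed.

Lemma fix_irr_out g : g \in N :\: M -> 'Fix_ito[g] = [set 0%R].
Proof.
case/setDP=> Ng M'g; have Gg := subsetP sNG g Ng.
apply/eqP; rewrite eq_sym eqEcard sub1set fix_irrE // inertia_irr0.
rewrite (subsetP (normal_norm nsPG)) // cards1.
rewrite card_fix_irr // -(cards1 [set (1 : gT)]) subset_leq_card //.
apply/subsetP=> X fixX; have NPg : g \in N :\: P.
  by rewrite inE Ng (contra (subsetP sPM g)).
have /imsetP[z Zz def_X] := subsetP (fix_classes_out NPg) _ fixX.
have zX := class_central cZZ Zz.
rewrite def_X zX inE; apply/eqP; congr [set _].
apply/eqP; apply: contraR M'g => ntz.
apply: (subsetP (centN_in _)) (_ : g \in 'C_N[z]); first by rewrite !inE ntz.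
rewrite inE Ng cent1C; apply/cent1P/commgP/conjg_fixP.
case/setIP: fixX => _ /afix1P /=; rewrite def_X zX conjg_set1.
exact: set1_inj.
Qed.

Lemma J1_0 : 0%R \in J1.
Proof.
by apply/J1P; rewrite inertia_irr0 (subset_trans sMG) ?normal_norm.
Qed.

Lemma inertiaN_J1 i : i \in J1 -> i != 0%R -> 'I_N['chi_i] = M.
Proof.
move=> /J1P sMI nzi; apply/eqP; rewrite eqEsubset subsetI sMN sMI !andbT.
apply/subsetP=> g /setIP[Ng Ig]; apply: contraR nzi => M'g.
have NMg : g \in N :\: M by rewrite inE M'g.
by rewrite -in_set1 -(fix_irr_out NMg) fix_irrE // (subsetP sNG).
Qed.

Lemma inertiaN_J2 i : i \notin J1 -> 'I_N['chi_i] = P.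
Proof.
move=> J1'i; apply/eqP; rewrite eqEsubset sub_Inertia // andbT.
apply/subsetP=> g /setIP[Ng Ig]; apply: contraR J1'i => P'g.
have Gg := subsetP sNG g Ng.
have [Mg | M'g] := boolP (g \in M).
  have MPg : g \in M :\: P by rewrite inE P'g.
  by rewrite -(fix_irr_M MPg) fix_irrE.
have NMg : g \in N :\: M by rewrite inE M'g.
have : i \in [set 0%R] by rewrite -(fix_irr_out NMg) fix_irrE.
by move/set1P->; apply: J1_0.
Qed.

Lemma index_MP : #|M : P| = #[c].
Proof.
apply/eqP; rewrite -(eqn_pmul2l (cardG_gt0 P)) Lagrange //.
by rewrite -(sdprod_card sdM).
Qed.

Lemma coprime_c : coprime #|P| #[c].
Proof.
by rewrite -index_MP (coprime_dvdr _ coPG) // -(Lagrange_index sMG sPM) dvdn_mull.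
Qed.

(** A linear extension of 'chi_l to Z <[c]> induces a character of M of degree
    #|P : Z|, which is prime to #[c] = #|M : P|.  So some constituent 'chi_s has
    a degree that #[c] does not divide, and the constituents of its restriction
    to P cannot have inertia group P in M. *)
Lemma central_Iirr_onto (l : Iirr Z) :
  exists2 i : Iirr P, i \in J1 & central_Iirr Z i = l.
Proof.
pose B := (Z <*> <[c]>)%G; have sZM := subset_trans sZP sPM.
have cZc : <[c]> \subset 'C(Z) by rewrite cycle_subG (subsetP cZM).
have abB : abelian B.
  by rewrite /B /= abelianY (cZZ : abelian Z) cycle_abelian.
have sBM : B \subset M by rewrite join_subG sZM cycle_subG.
have indexB : #|M : B| = #|P : Z|.
  have oB : #|B| = (#|Z| * #[c])%N.
    rewrite /= cent_joinEr // TI_cardMg //; apply/trivgP.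
    case/sdprodP: sdM => _ _ _ <-; exact: setSI.
  apply/eqP; rewrite -(eqn_pmul2l (cardG_gt0 B)) Lagrange // oB.
  by rewrite mulnAC Lagrange // (sdprod_card sdM).
have [m Bm] := constt_cfInd_irr l (joing_subl Z <[c]>).
have sZB : Z \subset B := joing_subl _ _.
have [s Ms ndvd_s] : exists2 s : Iirr M,
    s \in irr_constt ('Ind[M] 'chi[B]_m) & ~~ (#[c] %| deg s).
  apply/exists_inP; rewrite -negb_forall_in; apply/negP=> /forall_inP dvd_s.
  have: #[c] %| #|M : B|.
    have Ind1 : ('Ind[M] 'chi[B]_m)%R 1 = #|M : B|%:R%R.
      by rewrite cfInd1 // lin_char1 ?mulr1 //; apply/char_abelianP.
    rewrite -dvdC_nat; change (#|M : B|%:R%R \in dvdC #[c]).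
    rewrite -Ind1 [('Ind[M] 'chi[B]_m)%R]cfun_sum_constt.
    rewrite sum_cfunE; apply: rpred_sum => s Ms; rewrite cfunE degE.
    have /natrP[e ->] : '['Ind 'chi_m, 'chi_s] \in Num.nat.
      by rewrite Cnat_cfdot_char ?cfInd_char ?irr_char.
    by rewrite -natrM dvdC_nat dvdn_mull // dvd_s.
  rewrite indexB => dvd_c; case/negP: ntc; rewrite -order_eq1.
  rewrite -dvdn1 -(eqP coprime_c) dvdn_gcd dvdnn andbT.
  exact: dvdn_trans dvd_c (dvdn_indexg P Z).
have sl : l \in irr_constt ('Res[Z] 'chi_s).
  rewrite -(cfResRes _ sZB sBM).
  apply: (constt_Res_trans (j := m)); rewrite -?constt_Ind_Res //.
  by rewrite cfRes_char ?irr_char.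
have [i si] := constt_cfRes_irr P s.
exists i.
  apply: contraR ndvd_s => J1'i.
  have [|e ->] := dvd_deg_constt _ si; first exact: normalS sPM sMG nsPG.
  suffices -> : 'I_M['chi_i] = P by rewrite index_MP mulnA dvdn_mulr // dvdn_mull.
  apply/eqP; rewrite eqEsubset sub_Inertia // andbT.
  by rewrite (subset_trans (setSI _ sMN)) // inertiaN_J2.
apply: (constt_Res_central sZM cZM (i := s)) => //.
rewrite -(cfResRes _ sZP sPM).
apply: constt_Res_trans si _ (central_IirrP Z i).
by rewrite cfRes_char ?irr_char.
Qed.

(** The map is onto, and J1 and Irr Z have the same cardinality. *)
Lemma central_Iirr_inj : {in J1 &, injective (central_Iirr Z (Q := P))}.
Proof.
apply/imset_injP/eqP; rewrite card_J1.
have -> : central_Iirr Z (Q := P) @: J1 = [set: Iirr Z].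
  apply/eqP; rewrite -subTset; apply/subsetP=> l _.
  by have [i J1i <-] := central_Iirr_onto l; apply: imset_f.
by rewrite cardsT card_Iirr_abelian ?(cZZ : abelian Z).
Qed.

Lemma acts_J1 : [acts G, on J1 | ito].
Proof.
apply/subsetP=> g Gg; rewrite !inE Gg; apply/subsetP=> i /J1P sMI.
rewrite inE; apply/J1P => /=.
rewrite conjg_IirrE -conjg_inertia ?(subsetP (normal_norm nsPG)) //.
by rewrite -(normsP (normal_norm nsMG) g Gg) conjSg.
Qed.

Lemma fix_J1E g i : g \in G -> i \in J1 ->
  (g \in 'I['chi_i]) = (g \in 'I['chi_(central_Iirr Z i)]).
Proof.
move=> Gg J1i; rewrite -(fix_irrE nsPG) // -(fix_irrE nsZG) //.
have cJ := central_IirrJ sZP cZP _ nsZG nsPG Gg.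
apply/afix1P/afix1P=> /= fix_i; first by rewrite -cJ ?fix_i.
apply: central_Iirr_inj => //; last by rewrite cJ.
by rewrite (acts_act acts_J1).
Qed.

Lemma inertia_J1 (A : {group gT}) i : A \subset G -> i \in J1 ->
  'I_A['chi_i] = 'I_A['chi_(central_Iirr Z i)].
Proof.
move=> sAG J1i; apply/setP=> g; rewrite !in_setI.
by case Ag: (g \in A) => //=; rewrite fix_J1E // (subsetP sAG).
Qed.

Lemma card_fix_J1 g : g \in G ->
  #|'Fix_(J1 | ito)[g]| = #|'Fix_jto[g]|.
Proof.
move=> Gg; rewrite -(@card_in_imset _ _ (central_Iirr Z (Q := P))); last first.
  by move=> i j /setIP[J1i _] /setIP[J1j _]; apply: central_Iirr_inj.
congr #|pred_of_set _|; apply/setP=> l.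
have [i J1i <-] := central_Iirr_onto l; rewrite fix_irrE // -fix_J1E //.
apply/imsetP/idP=> [[j /setIP[J1j]]|Ii]; last first.
  by exists i; rewrite // inE J1i fix_irrE.
by rewrite fix_irrE // => Ij /(central_Iirr_inj J1i J1j) ->.
Qed.

Local Notation K2 := (classes P :\: classes Z).

Lemma acts_K2 : [acts G, on K2 | class_act G].
Proof. by apply: actsD; [apply: acts_classes nsPG | apply: acts_classes nsZG]. Qed.

Lemma acts_J2 : [acts G, on ~: J1 | ito].
Proof. by rewrite astabsC acts_J1. Qed.

(** Brauer's lemma holds for P, and for Z, whose irreducible characters
    correspond to J1 and whose classes are the classes of P inside Z. *)
Lemma card_fix_J2 g : g \in G ->
  #|'Fix_(~: J1 | ito)[g]| = #|'Fix_(K2 | class_act G)[g]|.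
Proof.
move=> Gg; apply/eqP; rewrite -(eqn_add2l #|'Fix_(J1 | ito)[g]|).
rewrite {2}card_fix_J1 // (card_fix_irr nsZG) //.
have -> : #|'Fix_(classes Z | class_act G)[g]| =
          #|'Fix_cto[g] :&: classes P :&: classes Z|.
  by rewrite -setIA (setIidPr classes_central) setIC.
have -> : 'Fix_(K2 | class_act G)[g] =
          ('Fix_cto[g] :&: classes P) :\: classes Z.
  by rewrite -setIDA setIC setIDA.
rewrite cardsID [_ :&: classes P]setIC -(card_fix_irr nsPG) //.
by rewrite ![_ :&: 'Fix_ito[g]]setIC -setDE cardsID.
Qed.

Hypothesis classG_out : {in P :\: Z, forall x, x ^: G \subset x ^: N}.
Hypothesis classK_in : {in Z, forall z, z ^: K \subset z ^: N}.
Hypothesis classG_in : exists2 z, z \in Z & ~~ (z ^: G \subset z ^: N).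

Lemma orbit_J2 i : i \notin J1 -> orbit ito G i = orbit ito N i.
Proof.
move=> J1'i.
apply: (orbit_eq_transfer sNG acts_J2 acts_K2 card_fix_J2); last by rewrite inE.
move=> _ /setDP[/imsetP[x Px ->] Z'x]; apply: orbit_class_eq => //.
apply: classG_out; rewrite inE Px andbT; apply: contra Z'x => Zx.
by rewrite (class_central cZP Zx) -(class_central cZZ Zx) mem_classes.
Qed.

Lemma orbit_irrZ l : orbit (irr_act nsZG) K l = orbit (irr_act nsZG) N l.
Proof.
have actsI := subset_trans sKG (acts_irr_setT nsZG).
have actsC := subset_trans sKG (acts_classes nsZG).
apply: (orbit_eq_transfer sNK actsI actsC) => // [g Kg|_ /imsetP[z Zz ->]].
  by rewrite setTI card_fix_irr // (subsetP sKG).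
by apply: (orbit_class_eq nsZG) => //; apply: classK_in.
Qed.

Lemma exists_orbit_irrZ :
  exists l, orbit (irr_act nsZG) G l != orbit (irr_act nsZG) N l.
Proof.
apply/existsP; rewrite -negb_forall; apply/negP=> /forallP eqO.
case: classG_in => z Zz /negP[]; have sZN := subset_trans sZP sPN.
apply: (class_orbit_eq nsZG) => //.
apply: (orbit_eq_transfer sNG (acts_classes nsZG) (acts_irr_setT nsZG)) => //.
- by move=> g Gg; rewrite setTI card_fix_irr.
- by move=> l _; apply/eqP/eqO.
exact: mem_classes.
Qed.

Hypothesis solGP : solvable (G / P).
Hypothesis cycGN : cyclic (G / N).
Hypothesis indexGK : #|G : K| = 3.
Hypothesis commMK : [~: M, K] \subset P.

(** The G-orbit of 'chi_i is its N-orbit, which has #|N : P| elements; and the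
    inertia group meets N in P, so that modulo P it embeds in G / N. *)
Lemma inertiaG_J2 i : i \notin J1 ->
  #|G : 'I_G['chi_i]| = #|N : P| /\ abelian ('I_G['chi_i] / P).
Proof.
move=> J1'i; split.
  rewrite -(card_orbit_irr nsPG) ?normal_sub // orbit_J2 // card_orbit_irr //.
  by rewrite inertiaN_J2.
apply: sub_der1_abelian; have sNIP : 'I_N['chi_i] \subset P.
  by rewrite inertiaN_J2.
apply: subset_trans sNIP; rewrite subsetI; apply/andP; split.
  apply: subset_trans (dergS 1 (Inertia_sub G 'chi_i)) _.
  by rewrite der1_min ?normal_norm // cyclic_abelian.
exact: subset_trans (der_sub 1 _) (subsetIr _ _).
Qed.

Lemma deg_J2 (i : Iirr G) (j : Iirr P) :
    j \in irr_constt ('Res[P] 'chi_i) -> j \notin J1 ->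
  deg i = (#|N : P| * deg j)%N.
Proof.
move=> ij J1'j; have [indexI abI] := inertiaG_J2 J1'j.
have [k ->] := deg_Clifford_coprime nsPG solGP coPG ij.
by rewrite indexI (deg_abelian k abI) muln1.
Qed.

(** The K-orbit of the central character is its N-orbit. *)
Lemma index_inertiaK_J1 j : j \in J1 -> j != 0%R ->
  #|K : 'I_K['chi_j]| = #|N : M|.
Proof.
move=> J1j nzj; rewrite (inertia_J1 sKG J1j) -(card_orbit_irr nsZG) //; last first.
  by rewrite (subset_trans sZP) // (subset_trans sPN).
rewrite orbit_irrZ card_orbit_irr // ?(subset_trans sZP) //.
by rewrite -(inertia_J1 sNG J1j) inertiaN_J1.
Qed.

(** Modulo P the inertia group in K has the central subgroup M / P, and the
    quotient by it is cyclic because the inertia group meets N in M. *)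
Lemma abelian_inertiaK j : j \in J1 -> j != 0%R -> abelian ('I_K['chi_j] / P).
Proof.
move=> J1j nzj; set A := 'I_K['chi_j].
have sAG : A \subset G := subset_trans (Inertia_sub _ _) sKG.
have sMA : M \subset A by rewrite subsetI (subset_trans sMN sNK); apply/J1P.
have nPA : A \subset 'N(P) := subset_trans sAG (normal_norm nsPG).
have nMA : A \subset 'N(M) := subset_trans sAG (normal_norm nsMG).
apply: (@cyclic_factor_abelian _ (M / P)%G).
  rewrite subsetI quotientS //= quotient_cents2r //.
  exact: subset_trans (commgS _ (Inertia_sub _ _)) commMK.
have isoM : A / P / (M / P) \isog A / M.
  apply: third_isog => //; first by apply: normalS nsPG; rewrite ?(subset_trans sPM).
  by apply: normalS nsMG.
rewrite (isog_cyclic isoM) /=.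
have tiA : N :&: A = M.
  by rewrite -(inertiaN_J1 J1j nzj) /A setIA (setIidPl sNK).
have /isog_cyclic -> : A / M \isog A / N.
  rewrite -tiA; apply: second_isog.
  exact: subset_trans sAG (normal_norm nsNG).
by apply: cyclicS cycGN; apply: quotientS.
Qed.

Lemma deg_J1 (i : Iirr G) (j : Iirr P) :
    j \in irr_constt ('Res[P] 'chi_i) -> j \in J1 -> j != 0%R ->
  exists x e, [/\ deg i = (x * deg j * e)%N, x %| 3 * #|N : M|, 0 < e & e <= 3].
Proof.
move=> ij J1j nzj; have [k ->] := deg_Clifford_coprime nsPG solGP coPG ij.
exists #|G : 'I_G['chi_j]|, (deg k); split=> //; last 2 first.
- exact: deg_gt0.
- have sAI : 'I_K['chi_j] \subset 'I_G['chi_j] by apply: setSI.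
  have sAIP : ('I_K['chi_j] / P)%G \subset ('I_G['chi_j] / P)%G by apply: quotientS.
  apply: leq_trans (deg_le_index k sAIP (abelian_inertiaK J1j nzj)) _.
  rewrite /= index_quotient_eq //; last 2 first.
  - by rewrite subIset // sub_Inertia ?orbT // (subset_trans sPN).
  - by rewrite (subset_trans (Inertia_sub _ _)) // normal_norm.
  have -> : 'I_K['chi_j]%G = ('I_G['chi_j] :&: K)%G.
    by apply/val_inj; rewrite /= setIAC (setIidPr sKG).
  rewrite indexgI -indexGK -(leq_pmul2r (cardG_gt0 K)) LagrangeMr.
  rewrite [X in _ <= X]mulnC Lagrange // subset_leq_card //.
  by rewrite mul_subG ?Inertia_sub.
rewrite -indexGK -(index_inertiaK_J1 J1j nzj) Lagrange_index ?subsetIl //.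
by rewrite -(Lagrange_index (Inertia_sub G _) (setSI _ sKG)) dvdn_mulr.
Qed.

(** Some character of Z has a larger orbit under G than under K; as #|G : K| is
    3, the orbit under G is 3 times the one under K. *)
Lemma exists_deg_dvd3 :
  exists i : Iirr G, 3 %| deg i /\ ~~ (Z \subset cfker 'chi_i).
Proof.
have [l neqO] := exists_orbit_irrZ; have sZN := subset_trans sZP sPN.
have sZK := subset_trans sZN sNK; have sZG := subset_trans sZK sKG.
have [i li] := constt_cfInd_irr l sZG; rewrite constt_Ind_Res in li.
exists i; split; last first.
  apply: contra neqO => /constt_Res_cfker/(_ li) ->.
  have orb0 (A : {group gT}) : orbit jto A 0%R = [set 0%R].
    apply/setP=> k; rewrite inE; apply/imsetP/eqP=> [[a _ ->]|->] /=.
      by rewrite conjg_Iirr0.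
    by exists 1; rewrite //= conjg_Iirr0.
  by rewrite !orb0.
have [e ->] := dvd_deg_constt nsZG li; rewrite mulnCA dvdn_mulr //.
set I := 'I_G['chi_l]%G.
have IK : 'I_K['chi_l] = I :&: K by rewrite /= setIAC (setIidPr sKG).
have eq1 : (3 * #|K : 'I_K['chi_l]| = #|G : I| * #|I : I :&: K|)%N.
  rewrite -indexGK Lagrange_index ?subsetIl // -IK Lagrange_index ?subsetIl //.
  exact: setSI.
apply: contraR neqO => ndvd.
have dvd3 : 3 %| #|I : I :&: K|.
  have: 3 %| #|G : I| * #|I : I :&: K| by rewrite -eq1 dvdn_mulr.
  by rewrite Euclid_dvdM // (negbTE ndvd).
have le3 : #|I : I :&: K| <= 3.
  rewrite indexgI -indexGK -(leq_pmul2r (cardG_gt0 K)) LagrangeMr.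
  rewrite [X in _ <= X]mulnC Lagrange // subset_leq_card //.
  by rewrite mul_subG ?Inertia_sub.
have eq3 : #|I : I :&: K| = 3.
  by apply/eqP; rewrite eqn_leq le3 dvdn_leq.
rewrite eq_sym eqEcard imsetS //= !card_orbit_irr //.
have <- : #|K : 'I_K['chi_l]| = #|N : 'I_N['chi_l]|.
  by rewrite -(card_orbit_irr nsZG) // orbit_irrZ card_orbit_irr.
by rewrite -(leq_pmul2l (isT : 0 < 3)) eq1 eq3 mulnC.
Qed.

Lemma deg_J2_or_J1 (i : Iirr G) : ~~ (P \subset cfker 'chi_i) ->
  (exists j : Iirr P, deg i = (#|N : P| * deg j)%N) \/
  ~~ (Z \subset cfker 'chi_i) /\ (exists (j : Iirr P) x e,
    [/\ deg i = (x * deg j * e)%N, x %| 3 * #|N : M|, 0 < e & e <= 3]).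
Proof.
move=> notkerP; have [j ij] := constt_cfRes_irr P i.
have [J1j | J1'j] := boolP (j \in J1); last by left; exists j; apply: deg_J2.
have nzj : j != 0%R.
  apply: contra notkerP => /eqP j0; apply: constt0_Res_cfker => //.
  by rewrite -j0.
right; split; last by exists j; apply: deg_J1.
apply: contra nzj => kerZ; apply/eqP/central_Iirr_inj; rewrite ?J1_0 //.
rewrite central_Iirr0 //; apply: (constt_Res_cfker kerZ).
rewrite -(cfResRes _ sZP (normal_sub nsPG)).
apply: constt_Res_trans ij _ (central_IirrP Z j).
by rewrite cfRes_char ?irr_char.
Qed.

Variable p : nat.
Hypothesis pP : p.-group P.

Lemma p_dvd_deg (j : Iirr P) : deg j != 1%N -> p %| deg j.
Proof.
have [k ->] := p_natP (pnat_dvd (deg_dvdG j) pP).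
by case: k => // k _; rewrite expnS dvdn_mulr.
Qed.

(** Above a character that is nontrivial on Z there is no linear character of P,
    as P^`(1) contains Z. *)
Lemma p_dvd_deg_nker (i : Iirr G) : Z \subset P^`(1) ->
  ~~ (Z \subset cfker 'chi_i) -> p %| deg i.
Proof.
move=> sZP' notkerZ; have [j ij] := constt_cfRes_irr P i.
have [e ->] := dvd_deg_constt nsPG ij; rewrite dvdn_mull // dvdn_mull //.
apply: p_dvd_deg; apply: contra notkerZ => /eqP deg1.
apply: constt0_Res_cfker => //; rewrite -(cfResRes _ sZP (normal_sub nsPG)).
apply: (constt_Res_trans (j := j)) => //; first by rewrite cfRes_char ?irr_char.
suffices <- : central_Iirr Z j = 0%R by apply: central_IirrP.
apply: constt_Res_cfker (central_IirrP Z j).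
apply: subset_trans sZP' (lin_char_der1 _).
by rewrite qualifE /= irr_char degE deg1 eqxx.
Qed.

(** A nonlinear character of P / Z has trivial central character, so it is not
    in J1: there, only the principal character has it. *)
Lemma exists_deg_pindex : ~~ abelian (P / Z) ->
  exists i : Iirr G, p * #|N : P| %| deg i /\ Z \subset cfker 'chi_i.
Proof.
move=> nabPZ; have nsZP : Z <| P := normalS sZP (normal_sub nsPG) nsZG.
have [k nlin_k] : exists k : Iirr (P / Z), 'chi_k \isn't a linear_char.
  apply/existsP; rewrite -negb_forall; apply: contra nabPZ => /forallP lin.
  by apply/char_abelianP.
pose j := mod_Iirr k.
have Dj : 'chi_j = ('chi_k %% Z)%CF by rewrite mod_IirrE.
have nlin_j : deg j != 1%N.
  apply: contra nlin_k => /eqP deg1.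
  by rewrite qualifE /= irr_char -(cfMod1 'chi_k) -Dj degE deg1 eqxx.
have kerj : Z \subset cfker 'chi_j by rewrite Dj cfker_mod.
have j0 : central_Iirr Z j = 0%R := constt_Res_cfker kerj (central_IirrP Z j).
have J1'j : j \notin J1.
  apply: contra nlin_j => J1j; suffices -> : j = 0%R.
    by rewrite -(eqr_nat algC) -degE irr0 cfun11.
  by apply: central_Iirr_inj; rewrite ?J1_0 // central_Iirr0.
have [i ij] := constt_cfInd_irr j (normal_sub nsPG).
rewrite constt_Ind_Res in ij; exists i; split.
  by rewrite (deg_J2 ij J1'j) mulnC dvdn_mul // p_dvd_deg.
apply: constt0_Res_cfker => //; rewrite -(cfResRes _ sZP (normal_sub nsPG)).
apply: (constt_Res_trans (j := j)) => //; first by rewrite cfRes_char ?irr_char.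
by rewrite -j0 central_IirrP.
Qed.

(** * The graph of G *)
Hypothesis pr_p : prime p.
Variables C S H : {group gT}.
Hypotheses (sdG : P ><| H = G) (sdH : C ><| S = H) (defN : P ><| C = N).
Hypothesis abC : abelian C.
Hypothesis few_fixed : \sum_(s in S^#) #|'C_C[s]| < #|C|.
Hypothesis notP'Z : ~~ (P^`(1) \subset Z).
Hypothesis lcn3 : 'L_3(P) = Z.
Hypothesis co_nN : coprime #|G : N| #|N|.
Hypothesis co_m6 : coprime #|K : N| 6.
Hypothesis co_c6 : coprime #[c] (6 * #|N : M|).

Lemma sub_der_P : Z \subset P^`(1).
Proof. by rewrite -lcn3 (lcn_sub_leq P (isT : 2 <= 3)). Qed.

Lemma abelian_NP : abelian (N / P).
Proof.
case/sdprodP: defN => _ <- _ _; rewrite quotientMidl; exact: quotient_abelian.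
Qed.

Lemma index_S : #|G : N| = #|S|.
Proof.
apply/eqP; rewrite -(eqn_pmul2l (cardG_gt0 N)) Lagrange //.
by rewrite -(sdprod_card defN) -mulnA (sdprod_card sdH) (sdprod_card sdG).
Qed.

Lemma indexGN3 : #|G : N| = (3 * #|K : N|)%N.
Proof. by rewrite -indexGK Lagrange_index. Qed.

Lemma card_PN : #|N| = (#|P| * #|N : P|)%N.
Proof. by rewrite Lagrange. Qed.

(** In G / P, a character lies above a linear character of the abelian Hall
    subgroup N / P. *)
Lemma deg_kerP (i : Iirr G) : P \subset cfker 'chi_i -> deg i %| #|G : N|.
Proof.
move=> kerP; pose k := quo_Iirr P i.
have -> : deg i = deg k by rewrite /deg quo_IirrE // cfQuo1.
have [j kj] := constt_cfRes_irr (N / P)%G k.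
have nPG := normal_norm nsPG.
have nsNP : N / P <| G / P by apply: quotient_normal.
have isoGN : G / P / (N / P) \isog G / N by apply: third_isog.
have iGN : #|G / P : N / P| = #|G : N|.
  by rewrite index_quotient_eq // subIset // sPN orbT.
have solGN : solvable (G / P / (N / P)) by apply: quotient_sol.
have coGN : coprime #|N / P| #|G / P : N / P|.
  by rewrite iGN coprime_sym (coprime_dvdr _ co_nN) ?dvdn_quotient.
have [l ->] := deg_Clifford_coprime nsNP solGN coGN kj.
rewrite (deg_abelian j abelian_NP) muln1 -iGN.
have sI := normal_sub (normal_Inertia 'chi_j (normal_sub nsNP)).
rewrite -(Lagrange_index (Inertia_sub (G / P) 'chi_j) sI) dvdn_pmul2l //.
apply: dvdn_trans (deg_dvdG l) _; rewrite card_quotient //.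
exact: normal_norm (normal_Inertia _ (normal_sub nsNP)).
Qed.

(** The primes dividing a degree above J1 divide #|P|, 6 or #|N : M|. *)
Lemma deg_J2_of_dvd (i : Iirr G) r : ~~ (P \subset cfker 'chi_i) ->
    prime r -> coprime r (6 * #|N : M|) -> ~~ (r %| #|P|) -> r %| deg i ->
  exists j : Iirr P, deg i = (#|N : P| * deg j)%N.
Proof.
move=> notkerP pr_r co_r r'P r_i.
case: (deg_J2_or_J1 notkerP) => // -[_ [j [x [e [def_i dvd_x e_gt0 le_e3]]]]].
case/negP: r'P; move: r_i; rewrite def_i !Euclid_dvdM //.
move: co_r; rewrite prime_coprime // => /negP nr.
case/orP=> [/orP[rx|rj]|re].
- case: nr; apply: dvdn_trans (dvdn_trans rx dvd_x) _.
  by rewrite -[6]/(2 * 3)%N -mulnA dvdn_mull.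
- exact: dvdn_trans rj (deg_dvdG j).
case: nr; apply: dvdn_mulr; apply: dvdn_trans re _.
by case: e e_gt0 le_e3 {def_i} => [|[|[|[|e]]]].
Qed.

Lemma prime_n_ndvdN r : r \in primes #|G : N| -> prime r /\ ~~ (r %| #|N|).
Proof.
rewrite mem_primes => /and3P[pr_r _ rn]; split=> //.
by rewrite -prime_coprime // (coprime_dvdl rn).
Qed.

Lemma ntP : P :!=: 1.
Proof. by apply: contraNneq notP'Z => ->; rewrite derg1 commG1 sub1G. Qed.

Lemma prime_pi1_dvdN s : s \in primes (p * #|N : P|) -> prime s /\ s %| #|N|.
Proof.
rewrite mem_primes => /and3P[pr_s _]; rewrite Euclid_dvdM // card_PN => dvd_s.
split=> //; case/orP: dvd_s => [sp|sw]; last exact: dvdn_mull.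
have [_ pP' _] := pgroup_pdiv pP ntP.
by apply: dvdn_mulr; apply: dvdn_trans sp _.
Qed.

Lemma coprime_pi0_pi1 r s :
  r \in primes #|G : N| -> s \in primes (p * #|N : P|) -> coprime r s.
Proof.
move=> /prime_n_ndvdN[pr_r r'N] /prime_pi1_dvdN[pr_s sN].
by rewrite prime_coprime //; apply: contra r'N => /dvdn_trans; apply.
Qed.

Lemma kerP_nadj (i : Iirr G) r s : P \subset cfker 'chi_i ->
  r \in primes #|G : N| -> s \in primes (p * #|N : P|) -> ~~ (s %| deg i).
Proof.
move=> /deg_kerP dvd_i _ /prime_pi1_dvdN[pr_s sN]; apply: contraL sN => si.
by rewrite -prime_coprime // (coprime_dvdl _ co_nN) // (dvdn_trans si).
Qed.

Lemma J2_ndvd_pi0 (i : Iirr G) (j : Iirr P) r : deg i = (#|N : P| * deg j)%N ->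
  r \in primes #|G : N| -> ~~ (r %| deg i).
Proof.
move=> -> /prime_n_ndvdN[_]; apply: contra => /dvdn_trans; apply.
by rewrite card_PN mulnC dvdn_pmul2r ?deg_dvdG // indexg_gt0.
Qed.

Lemma kerZ_nadj (i : Iirr G) r s : Z \subset cfker 'chi_i ->
    r \in primes #|G : N| -> s \in primes (p * #|N : P|) -> r %| deg i ->
  ~~ (s %| deg i).
Proof.
move=> kerZ r0 s1 ri; have [kerP|notkerP] := boolP (P \subset cfker 'chi_i).
  exact: kerP_nadj r0 s1.
case: (deg_J2_or_J1 notkerP) => [[j /J2_ndvd_pi0/(_ r0)]|[]]; first by rewrite ri.
by rewrite kerZ.
Qed.

Lemma primes_m_n r : r \in primes #|K : N| -> r \in primes #|G : N|.
Proof.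
rewrite !mem_primes indexg_gt0 => /and3P[-> _ rm].
by rewrite indexg_gt0 indexGN3 dvdn_mull.
Qed.

Lemma m_nadj (i : Iirr G) r s : r \in primes #|K : N| ->
  s \in primes (p * #|N : P|) -> r %| deg i -> ~~ (s %| deg i).
Proof.
move=> rm s1 ri; have r0 := primes_m_n rm; have [pr_r r'N] := prime_n_ndvdN r0.
have [kerP|notkerP] := boolP (P \subset cfker 'chi_i); first exact: kerP_nadj r0 s1.
case: (deg_J2_of_dvd notkerP pr_r _ _ ri) => [||j /J2_ndvd_pi0/(_ r0)].
- have rm' : r %| #|K : N| by move: rm; rewrite mem_primes => /and3P[].
  rewrite coprimeMr (coprime_dvdl rm' co_m6) prime_coprime //.
  apply: contra r'N => /dvdn_trans; apply.
  rewrite card_PN -(Lagrange_index sMN sPM).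
  by apply: dvdn_mull; apply: dvdn_mulr.
- by apply: contra r'N => /dvdn_trans; apply; rewrite card_PN dvdn_mulr.
by rewrite ri.
Qed.

Lemma c_nadj (i : Iirr G) r s : r \in primes #|G : N| -> s \in primes #[c] ->
  s %| deg i -> ~~ (r %| deg i).
Proof.
rewrite (mem_primes s) => r0 /and3P[pr_s _ sc] si.
have [kerP|notkerP] := boolP (P \subset cfker 'chi_i).
  have s1 : s \in primes (p * #|N : P|).
    rewrite mem_primes pr_s muln_gt0 prime_gt0 ?indexg_gt0 //=.
    by rewrite dvdn_mull // -(Lagrange_index sMN sPM) dvdn_mull // index_MP.
  by move: si; rewrite (negPf (kerP_nadj kerP r0 s1)).
case: (deg_J2_of_dvd notkerP pr_s _ _ si) => [||j /J2_ndvd_pi0/(_ r0)] //.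
  exact: coprime_dvdl sc co_c6.
by rewrite -prime_coprime // coprime_sym (coprime_dvdr sc coprime_c).
Qed.

Lemma exists_deg_n :
  exists2 i : Iirr G, #|G : N| %| deg i & P \subset cfker 'chi_i.
Proof.
have [k nk] := exists_deg_index sdH abC few_fixed.
have [i degi keri] := exists_deg_sdprod k sdG.
by exists i; rewrite // degi index_S.
Qed.

(** A Sylow subgroup Q for a prime other than p meets P trivially.  If its prime
    divides #|N|, then Q lies in N, and Q^`(1) in P; otherwise Q meets N
    trivially, and Q^`(1) lies in N. *)
Lemma unique_nonabelian : unique_nonabelian_Sylow p G P.
Proof.
have p'GP : p^'.-nat #|G : P|.
  rewrite p'natE // -prime_coprime // (coprime_dvdl _ coPG) //.
  by have [] := pgroup_pdiv pP ntP.
have sylP : p.-Sylow(G) P by rewrite /pHall normal_sub // pP.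
split=> //.
  apply: contra notP'Z => abP; by rewrite (derG1P abP) sub1G.
move=> Q /SylowP[q pr_q sylQ] nabQ; have sQG := pHall_sub sylQ.
have [eq_qp | neq_qp] := eqVneq q p.
  rewrite eq_qp in sylQ.
  exact: uniq_normal_Hall sylP nsPG (Hall_max sylQ).
have qQ := pHall_pgroup sylQ; case/negP: nabQ; apply/derG1P.
have sQ'N : Q^`(1) \subset N.
  rewrite (subset_trans (dergS 1 sQG)) // der1_min ?normal_norm //.
  exact: cyclic_abelian.
have sQ'Q := der_sub 1 Q.
have [qN | q'N] := boolP (q %| #|N|).
  have hallN : \pi(N).-Hall(G) N.
    by rewrite /pHall sNG pgroup_pi /= -coprime_pi' ?cardG_gt0 // coprime_sym.
  have sQN : Q \subset N.
    rewrite (sub_normal_Hall hallN) //; apply: sub_pgroup qQ => r.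
    rewrite inE => /eqP->; by rewrite inE /= mem_primes pr_q cardG_gt0.
  apply/trivgP; rewrite -(coprime_TIg (G := P) (H := Q)); last first.
    apply: pnat_coprime pP _; apply: sub_pgroup qQ => r.
    by rewrite !inE => /eqP->.
  rewrite subsetI sQ'Q andbT; apply: subset_trans (dergS 1 sQN) _.
  by rewrite der1_min ?abelian_NP // (subset_trans sNG) ?normal_norm.
apply/trivgP; rewrite -(coprime_TIg (G := N) (H := Q)); last first.
  rewrite coprime_sym; have [k ->] := p_natP qQ.
  by rewrite coprimeXl // prime_coprime.
by rewrite subsetI sQ'N.
Qed.

Local Notation pi0 := ([fset q in primes #|G : N|])%fset.
Local Notation pi1 := ([fset q in primes (p * #|N : P|)])%fset.

Lemma in_fset_seq (s : seq nat) q : (q \in [fset r in s])%fset = (q \in s).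
Proof. by rewrite inE. Qed.

Lemma pN_gt0 : 0 < p * #|N : P|.
Proof. by rewrite muln_gt0 prime_gt0 ?indexg_gt0. Qed.

Lemma deg_pi01 (i : Iirr G) q : prime q -> q %| deg i ->
  (q \in primes #|G : N|) || (q \in primes (p * #|N : P|)).
Proof.
move=> pr_q qi; rewrite !mem_primes pr_q indexg_gt0 pN_gt0 /=.
have : q %| #|G| by apply: dvdn_trans qi (deg_dvdG i).
rewrite -(Lagrange sNG) card_PN !Euclid_dvdM // => /orP[/orP[qP|->]|->] //.
  have := pnat_dvd qP pP; rewrite pnatE // inE => /eqP->.
  by rewrite dvdnn orbT.
by rewrite !orbT.
Qed.

Lemma nonabelian_PZ : ~~ abelian (P / Z).
Proof.
apply: contra notP'Z => abPZ; rewrite der1_min //.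
exact: subset_trans (normal_sub nsPG) (normal_norm nsZG).
Qed.
Lemma degs_G :
  [/\ forall d q, d \in cd G -> prime q -> q %| d ->
        (q \in primes #|G : N|) || (q \in primes (p * #|N : P|)),
      exists2 d, d \in cd G & #|G : N| %| d
    & exists2 d, d \in cd G & p * #|N : P| %| d].
Proof.
split=> [d q /cdP[i ->]||]; first exact: deg_pi01.
  by have [i ni _] := exists_deg_n; exists (deg i) => //; apply/cdP; exists i.
have [i [wi _]] := exists_deg_pindex nonabelian_PZ.
by exists (deg i) => //; apply/cdP; exists i.
Qed.

Lemma normal_lcn3 : 'L_3(P) <| G.
Proof. by rewrite lcn3. Qed.

Lemma degs_GZ (Q := (G / 'L_3(P))%G) :
  [/\ forall d q, d \in cd Q -> prime q -> q %| d ->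
        (q \in primes #|G : N|) || (q \in primes (p * #|N : P|)),
      exists2 d, d \in cd Q & #|G : N| %| d
    & exists2 d, d \in cd Q & p * #|N : P| %| d].
Proof.
split=> [d q /(cd_quotientP _ normal_lcn3)[i _ ->]||]; first exact: deg_pi01.
  have [i ni kerP] := exists_deg_n; exists (deg i) => //.
  apply/(cd_quotientP _ normal_lcn3); exists i => //.
  by rewrite /= lcn3; apply: subset_trans kerP.
have [i [wi kerZ]] := exists_deg_pindex nonabelian_PZ; exists (deg i) => //.
by apply/(cd_quotientP _ normal_lcn3); exists i; rewrite //= lcn3.
Qed.

Lemma pi0_prime q : q \in pi0 -> prime q /\ q \in primes #|G : N|.
Proof.
rewrite in_fset_seq => q0; split=> //.
by move: q0; rewrite mem_primes => /and3P[].
Qed.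

Lemma pi1_prime q : q \in pi1 -> prime q /\ q \in primes (p * #|N : P|).
Proof.
rewrite in_fset_seq => q0; split=> //.
by move: q0; rewrite mem_primes => /and3P[].
Qed.

Lemma pi0_neq_pi1 q r : q \in pi0 -> r \in pi1 -> q != r.
Proof.
case/pi0_prime=> pr_q q0 /pi1_prime[pr_r r1].
have := coprime_pi0_pi1 q0 r1; rewrite prime_coprime //.
by apply: contraNneq => ->.
Qed.

Lemma pi0_3 : 3 \in pi0.
Proof. by rewrite in_fset_seq mem_primes indexg_gt0 indexGN3 dvdn_mulr. Qed.

Lemma pi1_p : p \in pi1.
Proof. by rewrite in_fset_seq mem_primes pr_p pN_gt0 dvdn_mulr. Qed.

Lemma adjacent_3p : adjacent G 3 p.
Proof.
have [i [i3 notkerZ]] := exists_deg_dvd3.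
apply/adjacentP=> //; first exact: pi0_neq_pi1 pi0_3 pi1_p.
exists (deg i); split=> //; first by apply/cdP; exists i.
exact: p_dvd_deg_nker sub_der_P notkerZ.
Qed.

Lemma m_isolated q r : q \in primes #|K : N| -> r \in pi1 -> ~~ adjacent G q r.
Proof.
move=> qm r1; have q0 : q \in pi0 by rewrite in_fset_seq primes_m_n.
have neq := pi0_neq_pi1 q0 r1.
have [[pr_q _] [pr_r r1']] := (pi0_prime q0, pi1_prime r1).
apply/adjacentP=> // -[_ [/cdP[i ->] qi ri]].
by move: ri; rewrite (negPf (m_nadj qm r1' qi)).
Qed.

Lemma c_pi1 q : q \in primes #[c] -> q \in pi1.
Proof.
rewrite in_fset_seq !mem_primes pN_gt0 => /and3P[-> _ qc] /=.
by rewrite dvdn_mull // -(Lagrange_index sMN sPM) dvdn_mull // index_MP.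
Qed.

Lemma c_isolated q r : q \in primes #[c] -> r \in pi0 -> ~~ adjacent G q r.
Proof.
move=> qc r0; have q1 := c_pi1 qc.
have neq := pi0_neq_pi1 r0 q1.
have [[pr_r r0'] [pr_q _]] := (pi0_prime r0, pi1_prime q1).
rewrite adjacent_sym; apply/adjacentP=> // -[_ [/cdP[i ->] ri qi]].
by move: ri; rewrite (negPf (c_nadj r0' qc qi)).
Qed.

Lemma pi01_nadj_GZ (Q := (G / 'L_3(P))%G) q r :
  q \in pi0 -> r \in pi1 -> ~~ adjacent Q q r.
Proof.
move=> q0 r1; have neq := pi0_neq_pi1 q0 r1.
have [[pr_q q0'] [pr_r r1']] := (pi0_prime q0, pi1_prime r1).
apply/adjacentP=> // -[_ [/(cd_quotientP _ normal_lcn3)[i kerL ->] qi ri]].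
have kerZ : Z \subset cfker 'chi_i by rewrite -lcn3.
by move: ri; rewrite (negPf (kerZ_nadj kerZ q0' r1' qi)).
Qed.

Lemma component_GZ : component_pair p G P pi0 pi1.
Proof.
have [cdQ cd0 cd1] := degs_GZ.
split; last 1 first.
- move=> X; rewrite (clique_vertices cdQ cd0 cd1).
  apply: (component_two_cliques _ _ _ _ _ pi0_3 pi1_p pi01_nadj_GZ).
  + exact: adjacent_sym.
  + exact: (adjacent_vertices cdQ cd0 cd1).
  + by move=> x y; apply: clique_adjacent cd0.
  + by move=> x y; apply: clique_adjacent cd1.
- apply/eqP=> eq01; have := pi0_3; rewrite eq01 => r3.
  by have := pi0_neq_pi1 pi0_3 r3; rewrite eqxx.
exact: pi1_p.
Qed.

Lemma alphaE : alpha G pi0 pi1 = [fset q in primes #|K : N|]%fset.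
Proof.
apply/fsetP=> q; rewrite in_fset_seq !inE /= indexGN3; apply/andP/idP=> [[]|qm].
  rewrite mem_primes muln_gt0 indexg_gt0 => /and3P[pr_q _].
  rewrite Euclid_dvdM // dvdn_prime2 // => /orP[/eqP-> /allP/(_ _ pi1_p)|qm _].
    by rewrite adjacent_3p.
  by rewrite mem_primes pr_q indexg_gt0.
split; first by have := primes_m_n qm; rewrite indexGN3.
by apply/allP=> r; apply: m_isolated.
Qed.

Lemma delta_sup : ([fset q in primes #[c]] `<=` delta G pi0 pi1)%fset.
Proof.
apply/fsubsetP=> q; rewrite in_fset_seq => qc; rewrite !inE /=.
have:= c_pi1 qc; rewrite in_fset_seq => -> /=.
by apply/allP=> r; apply: c_isolated.
Qed.

Theorem diameter_three_core : 1 < #|K : N| ->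
  [/\ solvable G, has_diameter (vertices G) (adjacent G) 3,
      unique_nonabelian_Sylow p G P, component_pair p G P pi0 pi1 &
      #|` alpha G pi0 pi1| = size (primes #|K : N|) /\
      size (primes #[c]) <= #|` delta G pi0 pi1|].
Proof.
move=> m_gt1; split.
- by rewrite (series_sol nsPG) solGP (pgroup_sol pP).
- have [cdG cd0 cd1] := degs_G; rewrite (clique_vertices cdG cd0 cd1).
  have m_pr : pdiv #|K : N| \in primes #|K : N|.
    by rewrite mem_primes pdiv_prime // pdiv_dvd indexg_gt0.
  have c_gt1 : 1 < #[c] by rewrite ltn_neqAle eq_sym order_eq1 ntc order_gt0.
  have c_pr : pdiv #[c] \in primes #[c].
    by rewrite mem_primes pdiv_prime // pdiv_dvd order_gt0.
  have m0 : pdiv #|K : N| \in pi0 by rewrite in_fset_seq primes_m_n.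
  have c1 := c_pi1 c_pr.
  apply: (has_diameter3 _ _ _ _ pi0_3 pi1_p adjacent_3p m0 c1).
  + exact: adjacent_sym.
  + exact: (adjacent_vertices cdG cd0 cd1).
  + by move=> x y; apply: clique_adjacent cd0.
  + by move=> x y; apply: clique_adjacent cd1.
  + exact: pi0_neq_pi1.
  + by move=> r; apply: m_isolated.
  by move=> r r0; rewrite adjacent_sym; apply: c_isolated.
- exact: unique_nonabelian.
- exact: component_GZ.
split; first by rewrite alphaE card_fseq undup_id ?primes_uniq.
have <- : #|` [fset q in primes #[c]]%fset| = size (primes #[c]).
  by rewrite card_fseq undup_id ?primes_uniq.
exact: fsubset_leq_card delta_sup.
Qed.
End Core.

(** * Powers and additive maps in a finite field *)
Section FieldFacts.

Variables (F : finFieldType) (q m : nat).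
Local Notation n := (3 * m)%N.
Hypothesis char2 : 2 \in [pchar F]%R.
Hypothesis q2 : 2.-nat q.
Hypothesis q_gt1 : 1 < q.
Hypothesis cardF : #|F| = (q ^ n)%N.
Hypothesis m_gt1 : 1 < m.
Hypothesis odd_m : odd m.
Local Notation w := (q ^ n).-1.

Local Open Scope ring_scope.

Implicit Types x y z u : F.

Definition fr x := x ^+ q.

Lemma frD x y : fr (x + y) = fr x + fr y.
Proof.
rewrite /fr exprDn_pchar //; apply: sub_in_pnat q2 => r _; rewrite inE => /eqP->.
exact: char2.
Qed.

Lemma frM x y : fr (x * y) = fr x * fr y.
Proof. exact: exprMn. Qed.

Lemma fr0 : fr 0 = 0.
Proof. by rewrite /fr expr0n gtn_eqF // ltnW. Qed.

Lemma fr1 : fr 1 = 1.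
Proof. exact: expr1n. Qed.

Lemma frX k x : fr (x ^+ k) = fr x ^+ k.
Proof. by rewrite /fr -!exprM mulnC. Qed.

Lemma iter_fr k x : iter k fr x = x ^+ (q ^ k)%N.
Proof. by elim: k => [|k IHk] //=; rewrite IHk /fr -exprM expnSr. Qed.

Lemma iter_frn x : iter n fr x = x.
Proof. by rewrite iter_fr -cardF expf_card. Qed.

Lemma addxx x : x + x = 0.
Proof. by rewrite -mulr2n -mulr_natr pcharf0 ?mulr0. Qed.

Lemma addxK x y : x + y + y = x.
Proof. by rewrite -addrA addxx addr0. Qed.

Lemma mulrn_n x : x *+ n = x.
Proof.
by rewrite -[n]odd_double_half oddM odd_m -addnn !mulrnDr addxx addr0.
Qed.

Lemma n_gt0 : (0 < n)%N.
Proof. by rewrite muln_gt0 (ltnW m_gt1). Qed.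

Lemma w_gt0 : (0 < w)%N.
Proof. by rewrite -subn1 subn_gt0 -{1}(expn0 q) ltn_exp2l ?n_gt0. Qed.

Lemma expf_w x : x != 0 -> x ^+ w = 1.
Proof.
move=> nzx; apply: (mulfI nzx); rewrite -exprS prednK ?expn_gt0 ?(ltnW q_gt1) //.
by rewrite -cardF expf_card mulr1.
Qed.

Lemma expf_surj k x : (0 < k)%N -> coprime k w -> x != 0 ->
  exists2 u, u != 0 & u ^+ k = x.
Proof.
move=> k_gt0 co_kw nzx.
case: (egcdnP w k_gt0) => kk kw Bez _; rewrite (eqP co_kw) in Bez.
exists (x ^+ kk); first by rewrite expf_neq0.
by rewrite -exprM Bez exprD mulnC exprM expf_w // expr1n mul1r.
Qed.

Lemma expf_inj k x : coprime k w -> x != 0 -> x ^+ k = 1 -> x = 1.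
Proof.
move=> co_kw nzx xk1; have k_gt0 : (0 < w)%N := w_gt0.
case: (egcdnP k k_gt0) => kk kw Bez _; rewrite gcdnC (eqP co_kw) in Bez.
have : x ^+ (kk * w) = 1 by rewrite mulnC exprM expf_w ?expr1n.
by rewrite Bez exprD mulnC exprM xk1 expr1n mul1r expr1.
Qed.

Lemma card_fixed k : (0 < k)%N ->
  (#|[set x : F | x ^+ (q ^ k)%N == x]| <= q ^ k)%N.
Proof.
move=> k_gt0; have qk_gt1 : (1 < q ^ k)%N.
  by rewrite -{1}(expn0 q) ltn_exp2l.
pose p := ('X^(q ^ k) - 'X : {poly F})%R.
have sz_p : size p = (q ^ k).+1.
  by rewrite /p size_polyDl ?size_polyN ?size_polyX ?size_polyXn.
have nzp : p != 0 by rewrite -size_poly_eq0 sz_p.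
rewrite -ltnS -sz_p cardE; apply: max_poly_roots nzp _ (enum_uniq _).
apply/allP=> x; rewrite mem_enum inE => /eqP fix_x.
by rewrite /root /p !hornerE fix_x subrr.
Qed.

Lemma exists_moved k : (0 < k < n)%N -> exists x : F, x ^+ (q ^ k)%N != x.
Proof.
case/andP=> k_gt0 k_ltn; apply/existsP; rewrite -negb_forall.
apply/negP=> /forallP fix_all.
have := card_fixed k_gt0; rewrite leqNgt => /negP[].
have -> : [set x : F | x ^+ (q ^ k)%N == x] = setT.
  by apply/setP=> x; rewrite !inE fix_all.
by rewrite cardsT cardF ltn_exp2l.
Qed.

(** For phi = fr this is the trace to the subfield of order q. *)
Definition orbit_sum (phi : F -> F) x := \sum_(i < n) iter i phi x.

Section OrbitSum.

Variable phi : F -> F.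
Hypothesis phiD : forall x y, phi (x + y) = phi x + phi y.
Hypothesis phin : forall x, iter n phi x = x.

Lemma phi0 : phi 0 = 0.
Proof. by have := phiD 0 0; rewrite addr0 -{1}[phi 0]addr0 => /addrI. Qed.

Lemma phi_sum k (g : 'I_k -> F) : phi (\sum_i g i) = \sum_i phi (g i).
Proof. exact: (big_morph phi phiD phi0). Qed.

Lemma orbit_sumD x y : orbit_sum phi (x + y) = orbit_sum phi x + orbit_sum phi y.
Proof.
rewrite -big_split; apply: eq_bigr => i _ /=.
by elim: (nat_of_ord i) => //= k ->; apply: phiD.
Qed.

Lemma orbit_sum_phi x : orbit_sum phi (phi x) = orbit_sum phi x.
Proof.
apply: (addrI x); rewrite /orbit_sum; transitivity (\sum_(i < n.+1) iter i phi x).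
  by rewrite big_ord_recl /=; congr (_ + _); apply: eq_bigr => i _; rewrite -iterSr.
by rewrite big_ord_recr /= phin addrC.
Qed.

Lemma phi_orbit_sum x : phi (orbit_sum phi x) = orbit_sum phi x.
Proof.
rewrite -[RHS]orbit_sum_phi phi_sum; apply: eq_bigr => i _.
by rewrite -iterS iterSr.
Qed.

Lemma orbit_sum_fixed x : phi x = x -> orbit_sum phi x = x.
Proof.
move=> fix_x; transitivity (\sum_(i < n) x).
  by apply: eq_bigr => i _; elim: (nat_of_ord i) => //= k ->.
by rewrite sumr_const card_ord mulrn_n.
Qed.

(** Each x + phi^i x telescopes to a value of phi y + y; adding these up over
    i < n gives orbit_sum phi x + x because n is odd. *)
Lemma orbit_sum_decomp x : exists y, x = orbit_sum phi x + (phi y + y).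
Proof.
pose h k := \sum_(j < k) iter j phi x.
have hE k : phi (h k) + h k = iter k phi x + x.
  elim: k => [|k IHk]; first by rewrite /h big_ord0 phi0 addr0 addxx.
  rewrite /h big_ord_recr phiD -/(h k) addrACA IHk /= addrC -addrA.
  by rewrite [_ + (_ + x)]addrA addxx add0r.
exists (\sum_(i < n) h i); rewrite phi_sum -big_split /=.
rewrite (eq_bigr (fun i : 'I_n => iter i phi x + x)); last by move=> i _; apply: hE.
rewrite big_split /= addrA addxx add0r.
by rewrite sumr_const card_ord mulrn_n.
Qed.

End OrbitSum.

Lemma fr_decomp x : exists y t, fr t = t /\ x = t + (fr y + y).
Proof.
have [y def_x] := orbit_sum_decomp frD x; exists y, (orbit_sum fr x).
by split; first exact: phi_orbit_sum frD iter_frn _.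
Qed.

(** As n is odd, the fixed points of fr^2 are fixed by fr. *)
Lemma fr2_decomp x : exists y t, fr t = t /\ x = t + (fr (fr y) + y).
Proof.
pose phi y := fr (fr y).
have phiD y z : phi (y + z) = phi y + phi z by rewrite /phi !frD.
have phiE k y : iter k phi y = iter k fr (iter k fr y).
  by elim: k => //= k ->; rewrite /phi -!iterS -iterSr.
have phin y : iter n phi y = y by rewrite phiE !iter_frn.
have [y def_x] := orbit_sum_decomp phiD x; exists y, (orbit_sum phi x); split=> //.
set t := orbit_sum phi x; have tE : fr (fr t) = t := phi_orbit_sum phiD phin x.
have iter2 k : iter k.*2 fr t = t by elim: k => //= k ->.
have := iter_frn t; rewrite -[n]odd_double_half oddM odd_m /= iter2.
by [].
Qed.

(** For fr N1 = N, the orbit sum of N * (fr z + z) is that of (N1 + N) * z.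
    With z = t / (N1 + N), where t is the orbit sum of x, it is t, so that
    x + N * (fr z + z) has orbit sum 0 and is a value of fr y + y. *)
Lemma fr_decomp_twisted N x : fr N != N ->
  exists y z, x = (fr y + y) + N * (fr z + z).
Proof.
move=> movedN; pose N1 := iter n.-1 fr N.
have frN1 : fr N1 = N by rewrite /N1 -iterS (prednK n_gt0) iter_frn.
have nz : N1 + N != 0.
  apply: contra movedN => /eqP N1N; apply/eqP.
  have eqN : N1 = N by rewrite -[N1]addr0 -(addxx N) addrA N1N add0r.
  by rewrite eqN in frN1.
pose t := orbit_sum fr x; pose z := t / (N1 + N).
have frt : fr t = t := phi_orbit_sum frD iter_frn x.
have sumz : orbit_sum fr (N * (fr z + z)) = t.
  rewrite mulrDr (orbit_sumD frD) -{1}frN1 -frM (orbit_sum_phi iter_frn).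
  by rewrite -(orbit_sumD frD) -mulrDl mulrC divfK // orbit_sum_fixed.
have [y def] := orbit_sum_decomp frD (x + N * (fr z + z)).
exists y, z; move: def; rewrite (orbit_sumD frD) sumz -/t addxx add0r => <-.
by rewrite -addrA addxx addr0.
Qed.

End FieldFacts.

(** * Divisors of q^n - 1 *)
Section Arithmetic.

Variables q m : nat.
Local Notation n := (3 * m)%N.
Local Notation d := (q ^ 2 + q + 1)%N.
Local Notation w := (q ^ n).-1.
Hypothesis q_gt1 : 1 < q.
Hypothesis even_q : ~~ odd q.
Hypothesis odd_m : odd m.
Hypothesis m_gt1 : 1 < m.
Hypothesis co_nw : coprime n w.

Local Open Scope nat_scope.

Lemma q3_pred : (q ^ 3).-1 = q.-1 * d.
Proof.
rewrite predn_exp !big_ord_recl big_ord0; congr (_ * _).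
by rewrite /= /bump /= addn0 expn0 expn1 !addn1 addn0 add1n addnC.
Qed.

(** The quotient of q^n - 1 by q^3 - 1, congruent to m modulo d. *)
Definition geomq := \sum_(i < m) (q ^ 3) ^ i.

Lemma w_geomq : w = q.-1 * d * geomq.
Proof. by rewrite expnM predn_exp q3_pred. Qed.

Lemma d_gt0 : 0 < d.
Proof. by rewrite addn1. Qed.

Lemma d_dvd_w : d %| w.
Proof. by rewrite w_geomq dvdn_mulr // dvdn_mull. Qed.

Lemma w_div_d : w %/ d = q.-1 * geomq.
Proof. by rewrite w_geomq mulnAC mulnK ?d_gt0. Qed.

Lemma coprime_n_d : coprime n d.
Proof. exact: coprime_dvdr d_dvd_w co_nw. Qed.

Lemma coprime_d_m : coprime d m.
Proof. by rewrite coprime_sym (coprime_dvdl _ coprime_n_d) ?dvdn_mull. Qed.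

(** Modulo d the powers of q^3 are 1, so the sum is m, which is prime to d. *)
Lemma coprime_d_geomq : coprime d geomq.
Proof.
have q31 : q ^ 3 = 1 %[mod d].
  rewrite -(@prednK (q ^ 3)) ?expn_gt0 ?(ltnW q_gt1) // q3_pred -addn1.
  by rewrite modnMDl.
have -> : coprime d geomq = coprime d m.
  rewrite -coprime_modr -[RHS]coprime_modr; congr (coprime _ _).
  rewrite /geomq -modn_summ (eq_bigr (fun=> 1 %% d)) => [|i _].
    by rewrite modn_summ sum1_card card_ord.
  by rewrite -modnXm q31 modnXm exp1n.
exact: coprime_d_m.
Qed.

Lemma coprime_d_3 : coprime d 3.
Proof. by rewrite coprime_sym (coprime_dvdl _ coprime_n_d) ?dvdn_mulr. Qed.

Lemma coprime_d_predq : coprime d q.-1.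
Proof.
have -> : d = (q + 2) * q.-1 + 3 by case: q q_gt1 => // k _ /=; ring.
rewrite coprime_sym /coprime gcdnMDl -/(coprime _ _) coprime_sym.
apply: coprime_dvdl (dvdn_mulr m (dvdnn 3)) _.
by apply: coprime_dvdr co_nw; rewrite w_geomq -mulnA dvdn_mulr.
Qed.

Lemma coprime_d : coprime d (6 * (w %/ d)).
Proof.
rewrite w_div_d !coprimeMr coprime_d_predq coprime_d_geomq -[6]/(2 * 3).
rewrite coprimeMr coprime_d_3 !andbT coprimen2 !oddD oddX (negPf even_q).
by [].
Qed.

Lemma odd_w : odd w.
Proof.
have : ~~ odd (q ^ n) by rewrite oddX negb_or even_q -lt0n muln_gt0 (ltnW m_gt1).
have : 0 < q ^ n by rewrite expn_gt0 (ltnW q_gt1).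
by case: (q ^ n) => //= k _; rewrite negbK.
Qed.

Lemma dvdn_odd_expn1 k t : odd t -> k + 1 %| k ^ t + 1.
Proof.
move=> odd_t; have [-> | k_gt0] := posnP k; first exact: dvd1n.
have k2 : k ^ 2 = 1 %[mod k + 1].
  have -> : k ^ 2 = k.-1 * (k + 1) + 1 by case: k k_gt0 => // j _ /=; ring.
  by rewrite modnMDl.
rewrite -[t]odd_double_half odd_t expnD -mul2n expnM.
rewrite /dvdn -modnDml -modnMmr -modnXm k2 modnXm exp1n modnMmr modnDml muln1.
by rewrite expn1 modnn.
Qed.

Lemma coprime_q1_w : coprime (q + 1) w.
Proof.
have dvd : q + 1 %| q ^ n + 1 by rewrite dvdn_odd_expn1 // oddM odd_m.
have co2 : coprime (q + 1) 2 by rewrite coprimen2 oddD (negPf even_q).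
rewrite /coprime -dvdn1 -[X in _ %| X](eqP co2) dvdn_gcd dvdn_gcdl /=.
have eq2 : 2 = q ^ n + 1 - w.
  have : 0 < q ^ n by rewrite expn_gt0 (ltnW q_gt1).
  by case: (q ^ n) => // k _ /=; lia.
rewrite [X in _ %| X]eq2.
exact: dvdn_sub (dvdn_trans (dvdn_gcdl _ _) dvd) (dvdn_gcdr _ _).
Qed.

Lemma d_gt1 : 1 < d.
Proof. by rewrite addn1 ltnS addn_gt0 orbC (ltnW q_gt1). Qed.

End Arithmetic.

(** * The twisted polynomial group and its operators *)
Section Construction.

Variables (F : finFieldType) (q m : nat).
Local Notation n := (3 * m)%N.
Local Notation d := (q ^ 2 + q + 1)%N.
Local Notation w := (q ^ n).-1.
Hypothesis char2 : 2 \in [pchar F]%R.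
Hypothesis q2 : 2.-nat q.
Hypothesis q_gt1 : 1 < q.
Hypothesis cardF : #|F| = (q ^ n)%N.
Hypothesis m_gt1 : 1 < m.
Hypothesis odd_m : odd m.
Hypothesis m3 : ~~ (3 %| m).
Hypothesis co_nw : coprime n w.

Local Notation fr := (@fr F q).
Local Notation V := (F * F * F)%type.
Implicit Types (v : V) (u : {unit F}) (h : {perm V}).

(** The coefficients of X, X^2 and X^3 in the product of two polynomials with
    constant term 1, where X a = fr a X.  All groups below consist of
    permutations of the coefficient triples: P acts on them by right
    multiplication, through rho, and the operators by automorphisms. *)
Definition mulv v v' : V :=
  (v.1.1 + v'.1.1, v.1.2 + v'.1.2 + v.1.1 * fr v'.1.1,
   v.2 + v'.2 + v.1.1 * fr v'.1.2 + v.1.2 * fr (fr v'.1.1))%R.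

Local Notation v0 := ((0, 0, 0)%R : V).

Lemma mulvA : associative mulv.
Proof.
move=> [[a b] e] [[a' b'] e'] [[a'' b''] e'']; rewrite /mulv /=.
by congr (_, _, _); rewrite ?(frD char2 q2) ?frM; ring.
Qed.

Lemma mul0v : left_id v0 mulv.
Proof. by case=> [[a b] e]; rewrite /mulv /= !mul0r !add0r !addr0. Qed.

Lemma mulv0 : right_id v0 mulv.
Proof. by case=> [[a b] e]; rewrite /mulv /= !(fr0 F q_gt1) !mulr0 !addr0. Qed.

Lemma mulv_inj v : injective (mulv^~ v).
Proof.
move: v => [[a b] e] [[a1 b1] e1] [[a2 b2] e2]; rewrite /mulv /=.
by case=> /addIr <- /addIr/addIr <- /addIr/addIr/addIr <-.
Qed.

Definition rho v := perm (@mulv_inj v).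

Lemma rhoM v v' : rho (mulv v v') = rho v * rho v'.
Proof. by apply/permP=> x; rewrite permM !permE mulvA. Qed.

Lemma rho0 : rho v0 = 1.
Proof. by apply/permP=> x; rewrite permE perm1 mulv0. Qed.

Lemma rhoE v x : rho v x = mulv x v.
Proof. exact: permE. Qed.

Lemma rho_inj : injective rho.
Proof. by move=> v v' eq_v; rewrite -[v]mul0v -[v']mul0v -!rhoE eq_v. Qed.

Lemma group_set_rho (A : {set V}) : v0 \in A ->
  {in A &, forall v v', mulv v v' \in A} -> group_set (rho @: A).
Proof.
move=> A0 AM; apply/group_setP; split; first by rewrite -rho0 imset_f.
by move=> _ _ /imsetP[v Av ->] /imsetP[v' Av' ->]; rewrite -rhoM imset_f ?AM.
Qed.

Definition Pset := rho @: setT.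

Lemma group_set_P : group_set Pset.
Proof. exact: group_set_rho. Qed.
Canonical P_group := Group group_set_P.
Local Notation P := P_group.

Definition layer2 : {set V} := [set v | v.1.1 == 0%R].
Definition layer3 : {set V} := [set v | (v.1.1 == 0%R) && (v.1.2 == 0%R)].

Definition Zset := rho @: layer3.

Lemma group_set_Z : group_set Zset.
Proof.
apply: group_set_rho => [|v v']; rewrite !inE ?eqxx //= /mulv.
by move=> /andP[/eqP-> /eqP->] /andP[/eqP-> /eqP->] /=; rewrite !(addr0, mul0r, eqxx).
Qed.
Canonical Z_group := Group group_set_Z.
Local Notation Z := Z_group.

Lemma mem_P v : rho v \in P.
Proof. exact: imset_f. Qed.

Lemma P_P x : reflect (exists v, x = rho v) (x \in P).
Proof. by apply: (iffP imsetP) => [[v _ ->]|[v ->]]; exists v. Qed.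

Lemma mem_Z v : (rho v \in Z) = (v.1.1 == 0%R) && (v.1.2 == 0%R).
Proof. by rewrite mem_imset ?inE //; apply: rho_inj. Qed.

Lemma Z_P x : reflect (exists e, x = rho (0, 0, e)%R) (x \in Z).
Proof.
apply: (iffP imsetP) => [[[[a b] e]]|[e ->]].
  by rewrite inE => /andP[/= /eqP-> /eqP-> ->]; exists e.
by exists (0, 0, e)%R; rewrite // inE !eqxx.
Qed.

Lemma card_P : #|P| = (#|F| ^ 3)%N.
Proof.
rewrite card_imset; last exact: rho_inj.
by rewrite cardsT !card_prod !expnS expn0 muln1 mulnA.
Qed.

(** The automorphisms of (V, mulv), which normalize P, and fix the triple v0,
    on which P acts regularly. *)
Definition autv := [set h : {perm V} |
  [forall v, forall v', h (mulv v v') == mulv (h v) (h v')]].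

Lemma autvP h : reflect (forall v v', h (mulv v v') = mulv (h v) (h v')) (h \in autv).
Proof.
rewrite inE; apply: (iffP forallP) => [hM v v' | hM v].
  exact/eqP/(forallP (hM v)).
by apply/forallP=> v'; rewrite hM.
Qed.

Lemma group_set_autv : group_set autv.
Proof.
apply/group_setP; split; first by apply/autvP=> v v'; rewrite !perm1.
by move=> h h' /autvP hM /autvP hM'; apply/autvP=> v v'; rewrite !permM hM hM'.
Qed.
Canonical autv_group := Group group_set_autv.

Lemma rhoJ h v : h \in autv -> rho v ^ h = rho (h v).
Proof.
move/autvP=> hM; apply/permP=> x; rewrite conjgE !permM !rhoE hM.
by rewrite permKV.
Qed.

Lemma autv_v0 h : h \in autv -> h v0 = v0.
Proof.
move/autvP=> hM; apply: (@mulv_inj (h v0)).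
by rewrite -hM !mul0v.
Qed.

Lemma norm_autv : autv \subset 'N(P).
Proof.
apply/subsetP=> h Ah; rewrite inE; apply/subsetP=> _ /imsetP[_ /P_P[v ->] ->].
by rewrite rhoJ ?mem_P.
Qed.

Lemma TI_autv : P :&: autv = 1.
Proof.
apply/trivgP/subsetP=> _ /setIP[/P_P[v ->] /autv_v0]; rewrite rhoE mul0v => ->.
by rewrite rho0 inE.
Qed.

(** The substitution of val u * X for X. *)
Definition diag u v : V :=
  (val u * v.1.1, val u ^+ (q + 1) * v.1.2, val u ^+ d * v.2)%R.

Lemma diagM u u' v : diag (u * u') v = diag u' (diag u v).
Proof.
rewrite /diag /= !exprMn !mulrA ![(val u' * val u)%R]mulrC.
by rewrite ![(val u' ^+ _ * val u ^+ _)%R]mulrC.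
Qed.

Lemma diag1 v : diag 1 v = v.
Proof. by case: v => [[a b] e]; rewrite /diag /= !expr1n !mul1r. Qed.

Lemma diag_inj u : injective (diag u).
Proof. by apply: (can_inj (g := diag u^-1)) => v; rewrite -diagM mulgV diag1. Qed.

Definition dil u := perm (@diag_inj u).

Lemma dilM : {in setT &, {morph dil : u u' / u * u'}}.
Proof. by move=> u u' _ _; apply/permP=> v; rewrite permM !permE diagM. Qed.
Canonical dil_morphism := Morphism dilM.

Lemma dil_autv u : dil u \in autv.
Proof.
apply/autvP=> [[[a b] e]] [[a' b'] e']; rewrite !permE /diag /mulv /=.
congr (_, _, _); rewrite ?frM ?frX; rewrite /fr.
- by rewrite mulrDr.
- by rewrite addn1 !exprS; ring.
have -> : (d = q * q + q + 1)%N by rewrite expnS expn1.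
by rewrite !exprD !exprM !expr1; ring.
Qed.

Definition frobv v : V := (fr v.1.1, fr v.1.2, fr v.2).

Lemma fr_inj : injective fr.
Proof.
move=> x y eq_xy; rewrite -(iter_frn cardF x) -(iter_frn cardF y).
by rewrite -(prednK (n_gt0 m_gt1)) !iterSr eq_xy.
Qed.

Lemma frobv_inj : injective frobv.
Proof. by move=> [[a b] e] [[a' b'] e'] [/fr_inj-> /fr_inj-> /fr_inj->]. Qed.

Definition s := perm frobv_inj.

Lemma s_autv : s \in autv.
Proof.
apply/autvP=> [[[a b] e]] [[a' b'] e']; rewrite !permE /frobv /mulv /=.
by rewrite !(frD char2 q2) !frM.
Qed.

Lemma sX k v : (s ^+ k) v = (iter k fr v.1.1, iter k fr v.1.2, iter k fr v.2).
Proof.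
elim: k => [|k IHk]; first by rewrite perm1; case: v => [[]].
by rewrite expgSr permM IHk permE.
Qed.

Variable g : {unit F}.
Hypothesis gen_g : [set: {unit F}] = <[g]>.

Lemma dil_inj : 'injm dil.
Proof.
apply/injmP=> u u' _ _ /permP/(_ (1, 0, 0)%R); rewrite !permE /diag /= !mulr1.
by case=> eq_u _ _; apply: val_inj.
Qed.

Lemma order_dil u : #[dil u] = #[u].
Proof. by rewrite order_injm ?dil_inj ?inE. Qed.

Lemma order_g : #[g] = w.
Proof. by rewrite orderE -gen_g card_finField_unit cardF. Qed.

Local Notation C := <[dil g]>%G.
Local Notation S := <[s]>%G.
Local Notation c := (dil (g ^+ (w %/ d))).
Local Notation T := <[s ^+ 3]>%G.
Local Notation H := (C <*> S)%G.
Local Notation G := (P <*> H)%G.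
Local Notation M := (P <*> <[c]>)%G.
Local Notation N := (P <*> C)%G.
Local Notation K := (N <*> T)%G.

Lemma CgroupP x : reflect (exists u, x = dil u) (x \in C).
Proof.
have -> : C = dil @* setT :> {set _} by rewrite /= -morphim_cycle ?inE // -gen_g.
by apply: (iffP morphimP) => [[u _ _ ->]|[u ->]]; exists u; rewrite ?inE.
Qed.

Lemma dilJs u : dil u ^ s = dil (u ^+ q).
Proof.
apply/permP=> v; rewrite conjgE !permM; have := permKV s v.
case: (s^-1 v) => [[a b] e] <-; rewrite !permE /diag /frobv /=.
rewrite !FinRing.val_unitX !frM !frX; congr (_, _, _).
Qed.

Lemma dilJsX u k : dil u ^ (s ^+ k) = dil (u ^+ (q ^ k)).
Proof.
elim: k => [|k IHk]; first by rewrite conjg1 expg1.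
by rewrite expgSr conjgM IHk dilJs -expgM -expnSr.
Qed.

(** A smaller order would make all of F fixed by a proper power of fr. *)
Lemma order_s : #[s] = n.
Proof.
have dvd_n : #[s] %| n.
  rewrite order_dvdn; apply/eqP/permP=> v; rewrite sX perm1 !(iter_frn cardF).
  by case: v => [[]].
have n_gt0 := n_gt0 m_gt1.
apply/eqP; rewrite eqn_leq dvdn_leq //= leqNgt; apply/negP=> lt_sn.
have [|x] := exists_moved q_gt1 cardF (k := #[s]); first by rewrite order_gt0.
have /permP/(_ (x, 0, 0)%R) := expg_order s.
by rewrite sX perm1 => -[+ _ _]; rewrite iter_fr => ->; rewrite eqxx.
Qed.

Lemma order_T : #[s ^+ 3] = m.
Proof. by rewrite orderXdiv order_s ?mulKn // dvdn_mulr. Qed.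

Lemma order_c : #[c] = d.
Proof.
have dw := d_dvd_w q m; have w0 := w_gt0 q_gt1 m_gt1.
rewrite order_dil orderXdiv order_g ?dvdn_div //.
by rewrite -{1}(divnK dw) mulKn // divn_gt0 ?(dvdn_leq w0) // d_gt0.
Qed.

Lemma kernel_d u : u ^+ d = 1 -> dil u \in <[c]>.
Proof.
have [k ->] : exists k, u = g ^+ k by apply/cycleP; rewrite -gen_g inE.
move/eqP; rewrite -expgM -order_dvdn order_g.
rewrite -{1}(divnK (d_dvd_w q m)) dvdn_pmul2r ?d_gt0 // => /dvdnP[j ->].
by rewrite mulnC expgM morphX ?inE // mem_cycle.
Qed.

Lemma c_d : (g ^+ (w %/ d)) ^+ d = 1.
Proof. by rewrite -expgM divnK ?d_dvd_w // -order_g expg_order. Qed.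

Lemma norm_SC : S \subset 'N(C).
Proof.
rewrite cycle_subG inE; apply/subsetP=> _ /imsetP[_ /CgroupP[u ->] ->].
by rewrite dilJs; apply/CgroupP; exists (u ^+ q).
Qed.

Lemma TI_CS : C :&: S = 1.
Proof.
apply/trivgP/subsetP=> _ /setIP[/CgroupP[u ->] /cycleP[k /permP/(_ (1, 0, 0)%R)]].
rewrite permE sX /diag /= mulr1 => -[val_u _ _].
have -> : u = 1.
  by apply: val_inj; rewrite /= val_u; elim: k {val_u} => //= k ->; rewrite fr1.
by rewrite morph1 inE.
Qed.

Lemma sdH : C ><| S = H.
Proof. by rewrite sdprodEY ?norm_SC ?TI_CS. Qed.

Lemma C_autv : C \subset autv.
Proof. by rewrite cycle_subG dil_autv. Qed.

Lemma c_autv : <[c]> \subset autv.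
Proof. by rewrite cycle_subG dil_autv. Qed.

Lemma H_autv : H \subset autv.
Proof. by rewrite join_subG C_autv cycle_subG s_autv. Qed.

Lemma sd_autv (A : {group {perm V}}) : A \subset autv -> P ><| A = P <*> A.
Proof.
move=> sA; rewrite sdprodEY ?(subset_trans sA) ?norm_autv //.
by apply/trivgP; rewrite -TI_autv setIS.
Qed.

Lemma NgroupP x : x \in N -> exists v u, x = rho v * dil u.
Proof.
rewrite -(sdprodWY (sd_autv C_autv)) -(sdprodW (sd_autv C_autv)).
by case/mulsgP=> _ _ /P_P[v ->] /CgroupP[u ->] ->; exists v, u.
Qed.

Lemma dilE u v : dil u v = diag u v.
Proof. exact: permE. Qed.

Lemma frobv_e e : s (0, 0, e)%R = (0, 0, fr e)%R.
Proof. by rewrite permE /frobv /= !(fr0 F q_gt1). Qed.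

Lemma diag_e u e : diag u (0, 0, e)%R = (0, 0, val u ^+ d * e)%R.
Proof. by rewrite /diag /= !mulr0. Qed.

Lemma cent_ZP : P \subset 'C(Z).
Proof.
apply/centsP=> _ /P_P[[[a b] e] ->] _ /Z_P[e' ->]; rewrite /commute -!rhoM.
by rewrite /mulv /= !(fr0 F q_gt1) !(mulr0, mul0r, addr0, add0r) [(e + _)%R]addrC.
Qed.

Lemma cZM : M \subset 'C(Z).
Proof.
rewrite join_subG cent_ZP cycle_subG; apply/centP=> _ /Z_P[e ->].
apply/esym/commgP/conjg_fixP; rewrite rhoJ ?dil_autv // dilE diag_e.
by rewrite -FinRing.val_unitX c_d /= mul1r.
Qed.

Lemma normal_PG : P <| G.
Proof. by have [] := sdprod_context (sd_autv H_autv). Qed.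

Lemma sZP : Z \subset P.
Proof. by apply/subsetP=> _ /Z_P[e ->]; apply: mem_P. Qed.

Lemma normal_ZG : Z <| G.
Proof.
rewrite /normal (subset_trans sZP) ?joing_subl // join_subG.
rewrite cents_norm ?cent_ZP // join_subG !cycle_subG !inE.
rewrite /=; apply/andP; split; apply/subsetP=> _ /imsetP[_ /Z_P[e ->] ->].
  by rewrite rhoJ ?dil_autv // dilE diag_e; apply/Z_P; eexists.
by rewrite rhoJ ?s_autv // frobv_e; apply/Z_P; eexists.
Qed.

Lemma sCH : C \subset H. Proof. exact: joing_subl. Qed.
Lemma sTS : T \subset S. Proof. exact: cycleX. Qed.

Lemma S_cent_T : S \subset 'N(T).
Proof. by rewrite cents_norm // (sub_abelian_cent2 (cycle_abelian s)) ?sTS. Qed.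

Lemma normal_join (A : {group {perm V}}) : A \subset H -> H \subset 'N(P <*> A) ->
  P <*> A <| G.
Proof.
move=> sAH nAH; rewrite /normal genS ?setUS //= join_subG nAH andbT.
exact: subset_trans (joing_subl P A) (normG _).
Qed.

Lemma norm_PH : H \subset 'N(P).
Proof. exact: subset_trans H_autv norm_autv. Qed.

Lemma normal_NG : N <| G.
Proof.
apply: normal_join; rewrite ?sCH // normsY ?norm_PH //.
by rewrite join_subG normG norm_SC.
Qed.

Lemma scC : <[c]> \subset C.
Proof. by rewrite cycle_subG; apply/CgroupP; eexists. Qed.

Lemma normal_MG : M <| G.
Proof.
apply: normal_join; first exact: subset_trans scC sCH.
rewrite normsY ?norm_PH //; apply: char_norm_trans (_ : <[c]> \char C) _.
  by rewrite sub_cyclic_char ?scC ?cycle_cyclic.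
by rewrite join_subG normG norm_SC.
Qed.

Lemma defK : K :=: P <*> (C <*> T).
Proof. by rewrite /= joingA. Qed.

Lemma normal_KG : K <| G.
Proof.
rewrite defK; apply: normal_join; first by rewrite genS // setUS // sTS.
have sCCT : C \subset C <*> T := joing_subl _ _.
rewrite join_subG; apply/andP; split.
  by rewrite normsY ?(subset_trans sCH norm_PH) // (subset_trans sCCT) ?normG.
rewrite normsY ?(subset_trans (joing_subr C S) norm_PH) //.
by rewrite normsY ?norm_SC ?S_cent_T.
Qed.

Lemma exists_unit (z : F) : z != 0%R -> exists u, val u = z.
Proof. by rewrite -unitfE => Uz; exists (FinRing.unit F Uz). Qed.

Lemma even_q : ~~ odd q.
Proof.
have [k def_q] := p_natP q2; rewrite def_q oddX /= orbF.
by apply: contraTneq q_gt1 => k0; rewrite def_q k0.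
Qed.

Lemma rho_dil0 v u : (rho v * dil u) v0 = diag u v.
Proof. by rewrite permM rhoE mul0v dilE. Qed.

Lemma commute_rho_dil v u x : commute (rho v * dil u) (rho x) ->
  diag u (mulv x v) = mulv (diag u v) x.
Proof.
move/permP/(_ v0); rewrite [LHS]permM rho_dil0 rhoE => ->.
by rewrite !permM !rhoE mul0v dilE.
Qed.

Lemma val_neq0 u : val u != 0%R.
Proof. by rewrite -unitfE; apply: (valP u). Qed.

(** Conjugation by rho v * dil u multiplies the first nonzero coordinate of an
    element of P outside Z by u or u^(q+1), and this is 1 only for u = 1, as
    q + 1 is prime to q^n - 1. *)
Lemma centN_out : {in P :\: Z, forall x, 'C_N[x] \subset P}.
Proof.
move=> _ /setDP[/P_P[[[a b] e] ->]]; rewrite mem_Z /= => nab.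
apply/subsetP=> _ /setIP[/NgroupP[[[a1 b1] e1] [u ->]] /cent1P/commute_rho_dil].
rewrite /diag /mulv /= => -[eq_a eq_b _].
suffices -> : u = 1 by rewrite morph1 mulg1 mem_P.
move: eq_a; rewrite mulrDr addrC => /addrI eq_a.
apply: val_inj => /=; have [a0|nza] := eqVneq a 0%R; last first.
  by apply: (mulIf nza); rewrite eq_a mul1r.
move: eq_b nab; rewrite a0 eqxx /= !(fr0 F q_gt1) !(mul0r, mulr0, addr0).
rewrite mulrDr addrC => /addrI eq_b nzb.
apply: (expf_inj q_gt1 cardF m_gt1 (k := q + 1)) (val_neq0 u) _.
  by apply: coprime_q1_w; rewrite ?even_q.
by apply: (mulIf nzb); rewrite eq_b mul1r.
Qed.

Lemma centN_in : {in Z^#, forall z, 'C_N[z] \subset M}.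
Proof.
move=> z /setD1P[nt_z /Z_P[e def_z]]; rewrite def_z in nt_z *.
have nze : e != 0%R by apply: contra nt_z => /eqP->; rewrite rho0.
apply/subsetP=> _ /setIP[/NgroupP[[[a1 b1] e1] [u ->]] /cent1P/commute_rho_dil].
rewrite /diag /mulv /= => -[_ _]; rewrite !(fr0 F q_gt1) !(mul0r, mulr0, addr0).
rewrite mulrDr addrC => /addrI eq_e; rewrite groupM //.
  by rewrite mem_gen // inE mem_P.
rewrite mem_gen // inE kernel_d ?orbT //; apply: val_inj.
by rewrite FinRing.val_unitX; apply: (mulIf nze); rewrite eq_e mul1r.
Qed.

Lemma rhoJ_rho v v' x : mulv v x = mulv x v' -> rho v ^ rho x = rho v'.
Proof. by move=> eq_vx; rewrite conjgE -rhoM eq_vx rhoM mulKg. Qed.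

Lemma defG : G :=: N <*> S.
Proof. by rewrite /= joingA. Qed.

(** The group N A maps x ^ y to its N-class only, as A fixes it; and x is in
    that class. *)
Lemma class_sub_cent (A U : {group {perm V}}) x y :
    A \subset 'N(N) -> U \subset N <*> A -> y \in N -> A \subset 'C[x ^ y] ->
  x ^: U \subset x ^: N.
Proof.
move=> nNA sU Ny cA; apply/subsetP=> _ /imsetP[t /(subsetP sU) At ->].
have: y^-1 * t \in A * N.
  rewrite (normC nNA) -norm_joinEr // groupM // groupV.
  exact: subsetP (joing_subl N A) _ Ny.
case/mulsgP=> a k Aa Nk def_t.
have -> : t = y * (a * k) by rewrite -def_t mulKVg.
rewrite conjgM conjgM.
have -> : (x ^ y) ^ a = x ^ y.
  by apply/conjg_fixP/commgP; apply/cent1P; rewrite cent1C (subsetP cA).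
by rewrite -conjgM memJ_class // groupM.
Qed.

Lemma sSG : S \subset G.
Proof. exact: subset_trans (joing_subr C S) (joing_subr P H). Qed.
Lemma norm_SN : S \subset 'N(N).
Proof. exact: subset_trans sSG (normal_norm normal_NG). Qed.

Lemma mem_NP v : rho v \in N.
Proof. by rewrite mem_gen // inE mem_P. Qed.

Lemma mem_NC u : dil u \in N.
Proof. by rewrite mem_gen // inE; apply/orP; right; apply/CgroupP; exists u. Qed.

Lemma frobv_fixed v : fr v.1.1 = v.1.1 -> fr v.1.2 = v.1.2 -> fr v.2 = v.2 ->
  S \subset 'C[rho v].
Proof.
move=> fa fb fe; rewrite cycle_subG cent1C; apply/cent1P/commgP/conjg_fixP.
by rewrite rhoJ ?s_autv // permE /frobv fa fb fe; case: v {fa fb fe} => [[]].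
Qed.

(** The operators make the first nonzero coordinate 1; then conjugation by
    elements of P moves each later coordinate into the fixed field of fr, which
    represents F modulo the values of fr y + y, or of fr (fr y) + y. *)
Lemma classG_out : {in P :\: Z, forall x, x ^: G \subset x ^: N}.
Proof.
move=> x /setDP[Px Z'x].
suffices [y Ny cS] : exists2 y, y \in N & S \subset 'C[x ^ y].
  by apply: (class_sub_cent norm_SN _ Ny cS); rewrite defG.
have [[[a b] e] def_x] := P_P _ Px; rewrite def_x mem_Z /= in Z'x *.
have [a0 | nza] := eqVneq a 0%R.
  rewrite a0 eqxx /= in Z'x *.
  have co_q1 : coprime (q + 1) w by apply: coprime_q1_w; rewrite ?even_q.
  have nzb : (b^-1 != 0)%R by rewrite invr_eq0.
  have q1_gt0 : 0 < q + 1 by rewrite addn1.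
  have [z nzz zb] := expf_surj q_gt1 cardF q1_gt0 co_q1 nzb.
  have [u uz] := exists_unit nzz; pose e1 := (val u ^+ d * e)%R.
  have [y [t [frt def_t]]] := fr2_decomp char2 q2 cardF odd_m e1.
  exists (dil u * rho (y, 0, 0)%R); first by rewrite groupM ?mem_NC ?mem_NP.
  rewrite conjgM rhoJ ?dil_autv // dilE /diag /= mulr0 uz zb mulVf // -uz -/e1.
  rewrite (rhoJ_rho (v' := (0, 1, t)%R)); last first.
    rewrite /mulv /= !(fr0 F q_gt1) !fr1 !(mulr0, mul0r, mul1r, mulr1, addr0, add0r).
    by congr (_, _, _); rewrite def_t [(fr (fr y) + y)%R]addrC addrA (addxK char2).
  by apply: frobv_fixed; rewrite /= ?(fr0 F q_gt1) ?fr1.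
have [u ua] : exists u, val u = (a^-1)%R by apply: exists_unit; rewrite invr_eq0.
pose b1 := (val u ^+ (q + 1) * b)%R; pose e1 := (val u ^+ d * e)%R.
have [y [t [frt def_t]]] := fr_decomp char2 q2 cardF odd_m b1.
pose e2 := (e1 + b1 * fr (fr y) + y * fr t)%R.
have [y2 [t2 [frt2 def_t2]]] := fr_decomp char2 q2 cardF odd_m e2.
exists (dil u * rho (y, 0, 0)%R * rho (0, y2, 0)%R).
  by rewrite !groupM ?mem_NC ?mem_NP.
rewrite !conjgM rhoJ ?dil_autv // dilE /diag /= -/b1 -/e1 ua mulVf //.
rewrite (rhoJ_rho (v' := (1, t, e2)%R)); last first.
  rewrite /mulv /= !(fr0 F q_gt1) !fr1 !(mulr0, mul0r, mul1r, mulr1, addr0, add0r).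
  congr (_, _, _); first by rewrite addrC.
    by rewrite def_t [(fr y + y)%R]addrC addrA (addxK char2).
  by rewrite /e2 (addxK char2).
rewrite (rhoJ_rho (v' := (1, t, t2)%R)); last first.
  rewrite /mulv /= !(fr0 F q_gt1) !fr1 !(mulr0, mul0r, mul1r, mulr1, addr0, add0r).
  congr (_, _, _); first by rewrite addrC.
  by rewrite def_t2 [(fr y2 + y2)%R]addrC addrA (addxK char2).
by apply: frobv_fixed; rewrite /= ?fr1.
Qed.

Lemma layer3_fixed e : iter 3 fr e = e -> T \subset 'C[rho (0, 0, e)%R].
Proof.
move=> fe; rewrite cycle_subG cent1C; apply/cent1P/commgP/conjg_fixP.
by rewrite rhoJ ?groupX ?s_autv // sX fe /= !(fr0 F q_gt1).
Qed.

Lemma norm_TN : T \subset 'N(N).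
Proof. exact: subset_trans sTS norm_SN. Qed.

(** An element e is multiplied by u^d.  Modulo d-th powers it can be replaced by
    a power of e ^+ geomq, which lies in the subfield of order q^3: for this,
    geomq is prime to d. *)
Lemma classK_in : {in Z, forall z, z ^: K \subset z ^: N}.
Proof.
move=> _ /Z_P[e ->].
suffices [y Ny cT] : exists2 y, y \in N & T \subset 'C[rho (0, 0, e)%R ^ y].
  exact: (class_sub_cent norm_TN (subxx _) Ny cT).
have [-> | nze] := eqVneq e 0%R.
  by exists 1; rewrite // conjg1 layer3_fixed //= !(fr0 F q_gt1).
have d_gt0 := d_gt0 q; have co_d := coprime_d_geomq q_gt1 co_nw.
case: (egcdnP (geomq q m) d_gt0) => kd kw Bez _; rewrite (eqP co_d) in Bez.
have nzu : ((e ^+ kd)^-1 != 0)%R by rewrite invr_eq0 expf_neq0.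
have [u uE] := exists_unit nzu; exists (dil u); first exact: mem_NC.
rewrite rhoJ ?dil_autv // dilE diag_e uE; apply: layer3_fixed.
have -> : ((e ^+ kd)^-1 ^+ d * e = (e ^+ geomq q m) ^- kw)%R.
  have -> : ((e ^+ kd)^-1 ^+ d = (e ^+ (kd * d)%N)^-1)%R by rewrite exprVn exprM.
  by rewrite Bez exprD invfM expr1 mulfVK // mulnC exprM.
have q3_gt0 : 0 < q ^ 3 by rewrite expn_gt0 (ltnW q_gt1).
have fix_x : ((e ^+ geomq q m) ^+ (q ^ 3)%N = e ^+ geomq q m)%R.
  rewrite -(prednK q3_gt0) exprS -exprM mulnC q3_pred -w_geomq.
  by rewrite (expf_w q_gt1 cardF) ?mulr1.
by rewrite iter_fr exprVn [((_ ^+ kw) ^+ _)%R]exprAC fix_x.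
Qed.

(** For a generator g of the multiplicative group, g^q is not g times a d-th
    power, since d does not divide q - 1. *)
Lemma classG_in : exists2 z, z \in Z & ~~ (z ^: G \subset z ^: N).
Proof.
exists (rho (0, 0, val g)%R); first by apply/Z_P; eexists.
apply/negP=> /subsetP/(_ (rho (0, 0, val g)%R ^ s)) sGN.
have Gs : s \in G := subsetP sSG s (cycle_id s).
have /imsetP[x Nx] := sGN (memJ_class _ Gs).
have [v [u ->]] := NgroupP Nx; rewrite conjgM.
have -> : rho (0, 0, val g)%R ^ rho v = rho (0, 0, val g)%R.
  apply/conjg_fixP/commgP/commute_sym; apply: (centsP cent_ZP _ (mem_P v)).
  by apply/Z_P; eexists.
rewrite !rhoJ ?s_autv ?dil_autv // frobv_e dilE diag_e => /rho_inj[eq_g].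
have {eq_g} : g ^+ q = u ^+ d * g.
  by apply: val_inj; rewrite FinRing.val_unitM !FinRing.val_unitX.
rewrite -{1}(prednK (ltnW q_gt1)) expgSr => /mulIg gu.
have: g ^+ (q.-1 * (w %/ d)) = 1.
  rewrite expgM gu -expgM mulnC divnK ?d_dvd_w // -order_g orderE -gen_g.
  by rewrite expg_cardG ?inE.
move/eqP; rewrite -order_dvdn order_g -{1}(divnK (d_dvd_w q m)) mulnC.
have w0 := w_gt0 q_gt1 m_gt1.
rewrite dvdn_pmul2r ?divn_gt0 ?(dvdn_leq w0) ?d_dvd_w ?d_gt0 // => /dvdn_leq.
by lia.
Qed.

Lemma cyclicGN : cyclic (G / N).
Proof. by rewrite defG quotientYidl ?norm_SN // quotient_cyclic ?cycle_cyclic. Qed.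

Lemma card_N : #|N| = (#|P| * w)%N.
Proof. by rewrite -(sdprod_card (sd_autv C_autv)) -[#|C|]/#[_] order_dil order_g. Qed.

Lemma card_G : #|G| = (#|N| * n)%N.
Proof.
rewrite -(sdprod_card (sd_autv H_autv)) -(sdprod_card sdH) card_N.
by rewrite -[#|C|]/#[_] -[#|S|]/#[_] order_dil order_g order_s mulnA.
Qed.

Lemma TI_NS : N :&: S = 1.
Proof.
apply/card_le1_trivg; have := mul_cardG N S.
rewrite -norm_joinEr ?norm_SN // -defG card_G -[#|S|]/#[_] order_s.
have nn_gt0 : 0 < #|N| * n by rewrite muln_gt0 cardG_gt0 n_gt0.
by rewrite -[X in X = _]muln1 => /eqP; rewrite eqn_pmul2l // => /eqP <-.
Qed.

Lemma indexGN : #|G : N| = n.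
Proof.
apply/eqP; rewrite -(eqn_pmul2l (cardG_gt0 N)) Lagrange ?card_G //.
exact: normal_sub normal_NG.
Qed.

Lemma sNK : N \subset K. Proof. exact: joing_subl. Qed.

Lemma card_K : #|K| = (#|N| * m)%N.
Proof.
rewrite /= norm_joinEr ?norm_TN // TI_cardMg -?[#|T|]/#[_] ?order_T //.
by apply/trivgP; rewrite -TI_NS setIS ?sTS.
Qed.

Lemma indexKN : #|K : N| = m.
Proof. by apply/eqP; rewrite -(eqn_pmul2l (cardG_gt0 N)) Lagrange ?sNK // card_K. Qed.

Lemma indexGK : #|G : K| = 3.
Proof.
apply/eqP; rewrite -(eqn_pmul2l (cardG_gt0 K)) Lagrange ?(normal_sub normal_KG) //.
by rewrite card_G card_K -mulnA [(m * 3)%N]mulnC.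
Qed.

Lemma pgroupP2 : 2.-group P.
Proof. by rewrite /pgroup card_P cardF !pnatX q2. Qed.

Lemma solG : solvable G.
Proof.
rewrite (series_sol normal_NG) (abelian_sol (cyclic_abelian cyclicGN)) andbT.
have nsPN : P <| N by have [] := sdprod_context (sd_autv C_autv).
rewrite (series_sol nsPN) (pgroup_sol pgroupP2) /= abelian_sol //.
rewrite /= quotientYidl ?(subset_trans C_autv norm_autv) //.
by rewrite quotient_abelian ?cycle_abelian.
Qed.

Lemma commMK : [~: M, K] \subset P.
Proof.
have nPCT : C <*> T \subset 'N(P).
  by rewrite (subset_trans _ norm_PH) // join_subG sCH (subset_trans sTS) ?joing_subr.
rewrite defK -quotient_cents2.
- rewrite !quotientYidl //; last by rewrite (subset_trans c_autv) ?norm_autv.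
  apply: quotient_cents; rewrite cycle_subG /= centY inE; apply/andP; split.
    by rewrite -cycle_subG (sub_abelian_cent2 (cycle_abelian (dil g))) ?scC.
  rewrite cent_cycle cent1C; apply/cent1P/commute_sym/commgP/conjg_fixP.
  rewrite dilJsX; congr dil; apply: (mulIg (g ^+ (w %/ d))^-1).
  rewrite mulgV -{1}(@prednK (q ^ 3)) ?expn_gt0 ?(ltnW q_gt1) //.
  by rewrite expgSr mulgK q3_pred [(q.-1 * _)%N]mulnC expgM c_d expg1n.
- by rewrite join_subG normG (subset_trans c_autv) ?norm_autv.
by rewrite join_subG normG.
Qed.

Lemma cent_C_sX i : 0 < i -> #|'C_C[s ^+ i]| <= (q ^ i).-1.
Proof.
move=> i_gt0; pose U := [set u : {unit F} | val u ^+ (q ^ i)%N == val u]%R.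
have sub : 'C_C[s ^+ i] \subset dil @: U.
  apply/subsetP=> _ /setIP[/CgroupP[u ->] /cent1P/commgP/conjg_fixP].
  rewrite dilJsX => eq_u; rewrite imset_f // inE -FinRing.val_unitX.
  by apply/eqP; congr (val _); apply: (injmP dil_inj); rewrite ?inE.
apply: leq_trans (subset_leq_card sub) _.
apply: leq_trans (leq_imset_card _ _) _.
rewrite -(card_imset _ (val_inj : injective (val : {unit F} -> F))).
rewrite -ltnS prednK ?expn_gt0 ?(ltnW q_gt1) //.
apply: leq_trans (card_fixed F q_gt1 i_gt0).
rewrite [X in _ <= X](cardsD1 0%R) inE expr0n gtn_eqF ?expn_gt0 ?(ltnW q_gt1) // eqxx.
rewrite add1n ltnS subset_leq_card //; apply/subsetP=> _ /imsetP[u Uu ->].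
by rewrite !inE in Uu *; rewrite Uu val_neq0.
Qed.

(** The centralizer of s^i in C has at most q^i - 1 elements, and the sum of
    these numbers over 0 < i < n is less than q^n - 1. *)
Lemma few_fixed : \sum_(x in S^#) #|'C_C[x]| < #|C|.
Proof.
rewrite -[X in _ < X]/#[dil g] order_dil order_g.
have sum_lt k : 0 < k -> \sum_(i < k) (q ^ i).-1 < (q ^ k).-1.
  elim: k => // -[_ _|k IHk _]; first by rewrite big_ord1 expn0 expn1; lia.
  rewrite big_ord_recr /=; have := IHk isT; rewrite [(q ^ k.+2)%N]expnS.
  have : (0 < q ^ k.+1)%N by rewrite expn_gt0 (ltnW q_gt1).
  move: (\sum_(i < _) _) (q ^ k.+1)%N q_gt1 => x y; nia.
apply: leq_ltn_trans (sum_lt n (n_gt0 m_gt1)).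
have -> : S^# = [set s ^+ (i : nat) | i : 'I_n & i != 0 :> nat].
  apply/setP=> x; rewrite in_setD1; apply/andP/imsetP=> [[ntx /cyclePmin[i]]|[i]].
    rewrite order_s => lt_in def_x; exists (Ordinal lt_in); rewrite ?inE //=.
    by apply: contra ntx => /eqP i0; rewrite def_x i0.
  rewrite inE => nz_i ->; rewrite mem_cycle; split=> //.
  by rewrite -order_dvdn order_s gtnNdvd ?lt0n.
rewrite big_imset /=; last first.
  move=> i j _ _ /eqP; rewrite eq_expg_mod_order order_s !modn_small //.
  by move/eqP/val_inj.
rewrite big_mkcond /=; apply: leq_sum => i _; rewrite inE.
by case: eqP => //= /eqP nz_i; rewrite cent_C_sX // lt0n.
Qed.

Lemma commg_rhoP v v' v2 :
  [~ rho v, rho v'] = rho v2 <-> mulv v v' = mulv (mulv v' v) v2.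
Proof.
split=> [def_v2 | eq_v].
  by apply: rho_inj; rewrite !rhoM -def_v2 -commgC.
by apply: (mulgI (rho v' * rho v)); rewrite -commgC -!rhoM eq_v.
Qed.

Lemma group_set_layer2 : group_set (rho @: layer2).
Proof.
apply: group_set_rho => [|v v']; rewrite !inE ?eqxx //= /mulv /=.
by move=> /eqP-> /eqP->; rewrite addr0.
Qed.

Lemma commg_layers v v' : exists2 v2, [~ rho v, rho v'] = rho v2 &
  v2.1.1 = 0%R /\ (v.1.1 = 0%R -> v2.1.2 = 0%R).
Proof.
have [v2 def_v2] := P_P _ (groupR (mem_P v) (mem_P v')); exists v2 => //.
move/commg_rhoP: def_v2; case: v v' v2 => [[a b] e] [[a' b'] e'] [[a2 b2] e2].
rewrite /mulv /= => -[eq_a eq_b _].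
have a20 : a2 = 0%R by apply: (addrI (a + a')%R); rewrite addr0 {1}[(a + a')%R]addrC.
split=> // a0; move: eq_b; rewrite a20 a0 !(fr0 F q_gt1) !(mul0r, mulr0, addr0).
by rewrite [(b' + b)%R]addrC -{1}[(b + b')%R]addr0 => /addrI.
Qed.

Lemma der_P_layer2 : P^`(1) \subset rho @: layer2.
Proof.
rewrite (gen_subG _ (Group group_set_layer2)).
apply/subsetP=> _ /imset2P[_ _ /P_P[v ->] /P_P[v' ->] ->].
by have [v2 -> [v20 _]] := commg_layers v v'; apply: imset_f; rewrite inE v20.
Qed.

Lemma lcn3_sub : 'L_3(P) \subset Z.
Proof.
rewrite lcnSn gen_subG; apply/subsetP=> _ /imset2P[x _ Lx /P_P[v' ->] ->].
have /imsetP[v] := subsetP der_P_layer2 x Lx; rewrite inE => /eqP v1 ->.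
have [v2 -> [v20 /(_ v1) v21]] := commg_layers v v'.
by rewrite mem_Z v20 v21 !eqxx.
Qed.

Lemma n_gt1 : 1 < n.
Proof. by rewrite (leq_trans m_gt1) // leq_pmull. Qed.

(** The commutator of (z, 0, 0) and (z a1, 0, 0) has second coordinate
    z^(q+1) (fr a1 + a1), and z^(q+1) takes every nonzero value. *)
Lemma der_P_onto b : exists e, rho (0, b, e)%R \in P^`(1).
Proof.
have [-> | nzb] := eqVneq b 0%R; first by exists 0%R; rewrite rho0.
have [|a1] := exists_moved q_gt1 cardF (k := 1); first by rewrite n_gt1.
rewrite expn1 => nfix; have nzt : (fr a1 + a1 != 0)%R.
  apply: contra nfix => /eqP t0; rewrite -subr_eq0 oppr_pchar2 //.
  by rewrite -[(a1 ^+ q)%R]/(fr a1) t0.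
have q1_gt0 : 0 < q + 1 by rewrite addn1.
have co_q1 : coprime (q + 1) w by apply: coprime_q1_w; rewrite ?even_q.
have nzbt : (b / (fr a1 + a1) != 0)%R by rewrite mulf_neq0 ?invr_eq0.
have [z _ def_z] := expf_surj q_gt1 cardF q1_gt0 co_q1 nzbt.
have [v2 def_v2 [v20 _]] := commg_layers (z, 0, 0)%R ((z * a1)%R, 0, 0)%R.
exists v2.2; have -> : (0, b, v2.2)%R = v2.
  move/commg_rhoP: def_v2; case: v2 v20 => [[a2 b2] e2] /= ->.
  rewrite /mulv /= !(fr0 F q_gt1) !(mulr0, addr0, add0r) frM => -[_ eq_b _].
  congr (_, _, _); apply: (addrI (z * a1 * fr z)%R); rewrite -eq_b.
  have zz : (z * fr z)%R = (b / (fr a1 + a1))%R by rewrite -def_z addn1 exprS.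
  rewrite -[X in (_ + X)%R](divfK nzt) -zz mulrDr addrCA.
  by rewrite [(z * a1 * _)%R]mulrAC (addxx char2) addr0 mulrA.
rewrite -def_v2; apply: mem_commg; exact: mem_P.
Qed.

(** This is the commutator with (a, 0, 0) of a commutator whose second coordinate
    is a^(q+1) y. *)
Lemma lcn3_mem (a y : F) : rho (0, 0, a ^+ d * (fr y + y))%R \in 'L_3(P).
Proof.
pose b := (a ^+ (q + 1) * y)%R; have [e Pb] := der_P_onto b.
rewrite lcnSn; have <- : [~ rho (0, b, e)%R, rho (a, 0, 0)%R] =
    rho (0, 0, a ^+ d * (fr y + y))%R.
  apply/commg_rhoP; rewrite /mulv /= !(fr0 F q_gt1) !(mul0r, mulr0, addr0, add0r).
  have -> : (a ^+ d = a * fr a * fr (fr a))%R.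
    rewrite addn1 exprS exprD {1}/fr /fr -exprM mulnn; ring.
  have eq_b : b = (a * fr a * y)%R by rewrite /b addn1 exprS.
  congr (_, _, _); rewrite eq_b !frM.
  have -> : (a * (fr a * fr (fr a) * fr y) = a * fr a * fr (fr a) * fr y)%R by ring.
  by rewrite mulrDr addrA (addxK char2) mulrAC.
by apply: mem_commg; rewrite ?mem_P.
Qed.

Lemma lcn3_P : 'L_3(P) = Z.
Proof.
apply/eqP; rewrite eqEsubset lcn3_sub; apply/subsetP=> _ /Z_P[x ->].
have [|a] := exists_moved q_gt1 cardF (k := 3).
  by rewrite ltn_Pmulr.
move=> nfix; have nza : a != 0%R.
  by apply: contra nfix => /eqP->; rewrite expr0n gtn_eqF ?expn_gt0 ?(ltnW q_gt1).
have movedN : fr (a ^+ d)%R != (a ^+ d)%R.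
  apply: contra nfix => /eqP fixN; apply/eqP.
  have q3_gt0 : 0 < q ^ 3 by rewrite expn_gt0 (ltnW q_gt1).
  rewrite -(prednK q3_gt0) exprS q3_pred mulnC exprM.
  suffices -> : ((a ^+ d) ^+ q.-1 = 1)%R by rewrite mulr1.
  have nzN : (a ^+ d != 0)%R by rewrite expf_neq0.
  by apply: (mulfI nzN); rewrite -exprS (prednK (ltnW q_gt1)) mulr1.
have [y [z ->]] := fr_decomp_twisted char2 q2 cardF m_gt1 odd_m x movedN.
have := groupM (lcn3_mem 1%R y) (lcn3_mem a z).
rewrite -rhoM /mulv /= !(fr0 F q_gt1) expr1n !(mul0r, mul1r, addr0).
by [].
Qed.

Lemma notP'Z : ~~ (P^`(1) \subset Z).
Proof.
have [e Pb] := der_P_onto 1%R; apply/subsetP=> /(_ _ Pb).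
by rewrite mem_Z /= oner_eq0 andbF.
Qed.

Lemma odd_index : odd (w * n).
Proof. by rewrite !oddM odd_m !andbT odd_w ?even_q. Qed.

Lemma coPG : coprime #|P| #|G : P|.
Proof.
have -> : #|G : P| = (w * n)%N.
  apply/eqP; rewrite -(eqn_pmul2l (cardG_gt0 P)) Lagrange.
    by rewrite card_G card_N -mulnA.
  exact: joing_subl.
by rewrite (pnat_coprime pgroupP2) // p'natE // dvdn2 odd_index.
Qed.

Lemma co_nN : coprime n #|N|.
Proof.
rewrite card_N coprimeMr co_nw andbT coprime_sym (pnat_coprime pgroupP2) //.
by rewrite p'natE // dvdn2 oddM odd_m.
Qed.

Lemma indexNM : #|N : M| = w %/ d.
Proof.
have card_M : #|M| = (#|P| * d)%N.
  by rewrite -(sdprod_card (sd_autv c_autv)) -[#|<[c]>|]/#[_] order_c.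
apply/eqP; rewrite -(eqn_pmul2l (cardG_gt0 M)) Lagrange.
  by rewrite card_N card_M -mulnA [(d * _)%N]mulnC divnK ?d_dvd_w.
by rewrite genS // setUS // scC.
Qed.

Lemma coprime_m6 : coprime m 6.
Proof.
by rewrite (coprimeMr m 2 3) coprimen2 odd_m coprime_sym prime_coprime.
Qed.

Lemma twisted_group_graph :
  exists (p : nat) (pi0 pi1 : {fset nat}),
    [/\ solvable G, has_diameter (vertices G) (adjacent G) 3,
        unique_nonabelian_Sylow p G P, component_pair p G P pi0 pi1 &
        #|` alpha G pi0 pi1| = size (primes m) /\
        size (primes d) <= #|` delta G pi0 pi1|].
Proof.
have sMN : M \subset N by rewrite genS // setUS // scC.
have ntc : c != 1 by rewrite -order_gt1 order_c d_gt1.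
have solGP : solvable (G / P) := quotient_sol _ solG.
have co_c6 : coprime #[c] (6 * #|N : M|).
  rewrite order_c indexNM; apply: coprime_d => //; exact: even_q.
have co_m6 : coprime #|K : N| 6 by rewrite indexKN coprime_m6.
have co_GN : coprime #|G : N| #|N| by rewrite indexGN co_nN.
have m1 : 1 < #|K : N| by rewrite indexKN.
have core := diameter_three_core normal_ZG normal_PG normal_MG normal_NG
  normal_KG sZP sMN sNK (sd_autv c_autv) ntc cZM centN_out centN_in coPG
  classG_out classK_in classG_in solGP cyclicGN indexGK commMK pgroupP2
  _ (sd_autv H_autv) sdH (sd_autv C_autv) (cycle_abelian _) few_fixed notP'Z
  lcn3_P co_GN co_m6 co_c6 m1.
have [//|solG' diam syl comp card_ad] := core.
rewrite indexKN order_c in card_ad.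
do 3 eexists; split; first exact: solG'.
- exact: diam.
- exact: syl.
- exact: comp.
exact: card_ad.
Qed.

End Construction.

(** * The choice of m and f *)
Section Exponents.

Local Open Scope nat_scope.

(** Otherwise r would divide both 2^(s t) - 1 and 2^(s t) + 1. *)
Lemma prime_ndvd_odd_mersenne r s t : prime r -> 0 < s -> odd t ->
  r %| 2 ^ s + 1 -> ~~ (r %| (2 ^ t).-1).
Proof.
move=> pr_r s_gt0 odd_t rs; apply/negP=> rt.
have r_st : r %| (2 ^ (s * t)).-1.
  by apply: dvdn_trans rt _; rewrite mulnC expnM [X in _ %| X]predn_exp dvdn_mulr.
have r_st1 : r %| 2 ^ (s * t) + 1.
  by apply: dvdn_trans rs _; rewrite expnM dvdn_odd_expn1.
have : r %| 2.
  have -> : 2 = 2 ^ (s * t) + 1 - (2 ^ (s * t)).-1.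
    have : 0 < 2 ^ (s * t) by rewrite expn_gt0.
    by case: (2 ^ _) => // k _ /=; lia.
  exact: dvdn_sub.
rewrite dvdn_prime2 // => /eqP r2; move: rs.
by rewrite r2 dvdn2 oddD oddX /= orbF gtn_eqF.
Qed.

(** By Euler's theorem 2 ^ totient (3 * m) + 1 is 2 modulo the odd number 3 * m,
    so a prime divisor of it is new. *)
Lemma exists_odd_order_free a : exists m,
  [/\ odd m, size (primes m) = a, ~~ (3 %| m) &
      forall r, r \in primes m -> exists2 s, 0 < s & r %| 2 ^ s + 1].
Proof.
elim: a => [|a [m [odd_m size_m m3 mP]]]; first by exists 1.
have m_gt0 : 0 < m by case: m odd_m {size_m m3 mP}.
pose s := totient (3 * m); pose r := pdiv (2 ^ s + 1).
have s_gt0 : 0 < s by rewrite totient_gt0 muln_gt0.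
have gt1 : 1 < 2 ^ s + 1 by rewrite addn1 ltnS expn_gt0.
have pr_r : prime r := pdiv_prime gt1.
have r_gt0 := prime_gt0 pr_r.
have r_s : r %| 2 ^ s + 1 := pdiv_dvd _.
have odd_r : odd r.
  apply: contraLR r_s; rewrite -dvdn2 => r2; apply/negP=> /(dvdn_trans r2).
  by rewrite dvdn2 oddD oddX /= orbF gtn_eqF.
have r'm : ~~ (r %| 3 * m).
  apply/negP=> r_m; have : 2 ^ s = 1 %[mod 3 * m].
    by apply: Euler_exp_totient; rewrite coprime2n oddM odd_m.
  move/eqP; rewrite eqn_mod_dvd ?expn_gt0 // => /(dvdn_trans r_m).
  rewrite subn1 => r_s1; have : r %| 2.
    have -> : 2 = 2 ^ s + 1 - (2 ^ s).-1.
      have : 0 < 2 ^ s by rewrite expn_gt0.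
      by case: (2 ^ s) => // k _ /=; lia.
    exact: dvdn_sub.
  by rewrite dvdn_prime2 // => /eqP r2; rewrite r2 in odd_r.
move: (r'm); rewrite Euclid_dvdM // negb_or => /andP[r3 r_m].
exists (m * r); split.
- by rewrite oddM odd_m.
- have /perm_size -> : perm_eq (primes (m * r)) (r :: primes m).
    apply: uniq_perm; first exact: primes_uniq.
      rewrite /= primes_uniq andbT mem_primes pr_r m_gt0 /=.
      by move: r'm; rewrite Euclid_dvdM // negb_or => /andP[].
    move=> x; rewrite primesM // (primes_prime pr_r).
    by rewrite !in_cons in_nil orbF orbC.
  by rewrite /= size_m.
- by rewrite Euclid_dvdM // negb_or m3 dvdn_prime2 // eq_sym -dvdn_prime2.
move=> x; rewrite primesM // (primes_prime pr_r) mem_seq1 => /orP[/mP//|/eqP->].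
by exists s.
Qed.

(** With Phi(x) = x^2 + x + 1, the factor Q of Phi(x^5) = Phi(x) Q is congruent
    to - 5 x modulo Phi(x), which has no common divisor with 5 nor with x. *)
Lemma exists_many_primes b : exists2 f, odd f &
  b <= size (primes ((2 ^ f) ^ 2 + 2 ^ f + 1)).
Proof.
elim: b => [|b [f odd_f le_b]]; first by exists 1.
exists (f * 5); first by rewrite oddM odd_f.
rewrite expnM; set x := 2 ^ f in le_b *.
have x_gt1 : 1 < x.
  by rewrite -{1}(expn0 2) ltn_exp2l // lt0n; apply: contraTneq odd_f => ->.
pose Q := x ^ 8 + x ^ 5 + x ^ 3 + 1 - (x ^ 7 + x ^ 4 + x).
have lt_Q : x ^ 7 + x ^ 4 + x + 1 < x ^ 8 + x ^ 5 + x ^ 3 + 1.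
  have lt87 : x ^ 7 < x ^ 8 by rewrite ltn_exp2l.
  have lt54 : x ^ 4 < x ^ 5 by rewrite ltn_exp2l.
  have lt31 : x ^ 1 < x ^ 3 by rewrite ltn_exp2l.
  by rewrite expn1 in lt31; lia.
have PhiQ : (x ^ 5) ^ 2 + x ^ 5 + 1 = (x ^ 2 + x + 1) * Q.
  rewrite /Q mulnBr; apply: (@addIn ((x ^ 2 + x + 1) * (x ^ 7 + x ^ 4 + x))).
  rewrite subnK; first by ring.
  by rewrite leq_mul2l; apply/orP; right; lia.
have Q_gt1 : 1 < Q by rewrite /Q; lia.
have QB : Q + (x ^ 7 + x ^ 4 + x) = x ^ 8 + x ^ 5 + x ^ 3 + 1.
  by rewrite subnK; lia.
have coQ : coprime (x ^ 2 + x + 1) Q.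
  have Phi_gt0 : 0 < x ^ 2 + x + 1 by rewrite addn1.
  rewrite coprime_has_primes ?(ltnW Q_gt1) //; apply/hasPn=> r.
  rewrite !mem_primes => /and3P[pr_r _ rQ]; rewrite pr_r Phi_gt0 /=; apply/negP=> rPhi.
  have : r %| Q + 5 * x + (x ^ 2 + x + 1) * (2 * x ^ 5 + 4 * x ^ 2).
    have -> : Q + 5 * x + (x ^ 2 + x + 1) * (2 * x ^ 5 + 4 * x ^ 2) =
        (x ^ 2 + x + 1) * (x ^ 6 + x ^ 4 + 2 * x ^ 3 + 3 * x + 1).
      apply: (@addIn (x ^ 7 + x ^ 4 + x)); rewrite addnAC [_ + 5 * x + _]addnAC QB.
      by ring.
    exact: dvdn_mulr.
  rewrite dvdn_addl ?dvdn_mulr // dvdn_addr // Euclid_dvdM // => /orP[r5|rx].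
    move: r5 rPhi; rewrite dvdn_prime2 // => /eqP->; apply/negP.
    have j_lt := ltn_pmod x (isT : 0 < 5); rewrite (divn_eq x 5).
    move: (x %/ 5) (x %% 5) j_lt => k j j_lt.
    have -> : (k * 5 + j) ^ 2 + (k * 5 + j) + 1 =
      k * (k * 5 + 2 * j + 1) * 5 + (j ^ 2 + j + 1) by ring.
    rewrite dvdn_addr ?dvdn_mull //.
    by case: j j_lt => [|[|[|[|[|j]]]]].
  move: rPhi; have -> : x ^ 2 + x + 1 = x * (x + 1) + 1 by ring.
  by rewrite dvdn_addr ?dvdn_mulr // Euclid_dvd1.
rewrite PhiQ; set Phi := x ^ 2 + x + 1 in le_b coQ *.
have Phi_gt0 : 0 < Phi by rewrite /Phi addn1.
have pr_Q := pdiv_prime Q_gt1.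
have uniqQ : uniq (pdiv Q :: primes Phi).
  rewrite /= primes_uniq andbT mem_primes pr_Q Phi_gt0 /= -prime_coprime //.
  by rewrite coprime_sym (coprime_dvdr (pdiv_dvd Q) coQ).
apply: leq_trans (uniq_leq_size uniqQ _); first by rewrite ltnS.
move=> y; rewrite primesM ?(ltnW Q_gt1) // inE => /orP[/eqP->|->] //.
by rewrite [X in _ || X]mem_primes pr_Q pdiv_dvd (ltnW Q_gt1) orbT.
Qed.

End Exponents.

Theorem theoremA :
  forall a b : nat, 0 < a -> 0 < b ->
  exists (gT : finGroupType) (G P : {group gT}) (p : nat)
         (pi0 pi1 : {fset nat}),
    [/\ solvable G,
        has_diameter (vertices G) (adjacent G) 3,
        unique_nonabelian_Sylow p G P,
        component_pair p G P pi0 pi1 &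
        #|` alpha G pi0 pi1| = a /\ b <= #|` delta G pi0 pi1|].
Proof.
move=> a b a_gt0 _; have [m [odd_m size_m m3 mP]] := exists_odd_order_free a.
have [f odd_f le_b] := exists_many_primes b.
have m_gt1 : 1 < m.
  case: m odd_m size_m {m3 mP} => [|[|m]] // _ eq0.
  by rewrite -eq0 in a_gt0.
have m_gt0 := ltnW m_gt1; have f_gt0 : 0 < f := odd_gt0 odd_f.
have fn_gt0 : 0 < f * (3 * m) by rewrite !muln_gt0 f_gt0.
have [F charF cardF] := PrimePowerField (isT : prime 2) fn_gt0.
rewrite expnM in cardF; set q := (2 ^ f)%N in cardF le_b.
have q2 : 2.-nat q by rewrite pnatX.
have q_gt1 : 1 < q by rewrite /q -{1}(expn0 2) ltn_exp2l.
have co_nw : coprime (3 * m) (q ^ (3 * m)).-1.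
  rewrite coprime_has_primes ?muln_gt0 ?m_gt0 //; last first.
    by rewrite -subn1 subn_gt0 -{1}(expn0 q) ltn_exp2l ?muln_gt0 ?m_gt0.
  apply/hasPn=> r; rewrite mem_primes -expnM => /and3P[pr_r _ r_w].
  apply/negP=> r_n; have [s s_gt0 r_s] : exists2 s, 0 < s & r %| 2 ^ s + 1.
    move: r_n; rewrite primesM // => /orP[|/mP//].
    by rewrite primes_prime // inE => /eqP->; exists 1%N.
  have odd_fn : odd (f * (3 * m)) by rewrite !oddM odd_f odd_m.
  by have := prime_ndvd_odd_mersenne pr_r s_gt0 odd_fn r_s; rewrite r_w.
have [g gen_g] := cyclicP (field_unit_group_cyclic [set: {unit F}]%G).
have [p [pi0 [pi1 [solG diam syl comp [card_a card_d]]]]] :=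
  twisted_group_graph charF q2 q_gt1 cardF m_gt1 odd_m m3 co_nw gen_g.
do 6 eexists; split; [exact: solG | exact: diam | exact: syl | exact: comp |].
by rewrite card_a size_m; split; last exact: leq_trans card_d.
Qed.
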